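(* Let $0<p<\infty$ and let $u,v,w$ be weights on $(0,\infty)$ with $\lim_{t\to\infty}\underline v(t,\infty)=0$. Assume that $u$ is such that $U$ is admissible. Let $$\varphi(t)=\operatorname*{ess\,sup}_{s\in(0,t)}U(s)^{\frac1p}\operatorname*{ess\,sup}_{\tau\in(s,\infty)}\frac{w(\tau)}{U(\tau)^{\frac1p}},\qquad t\in(0,\infty),$$ be non-degenerate with respect to $U^{1/p}$. Consider the inequality $$\operatorname*{ess\,sup}_{t\in(0,\infty)}w(t)\left(\frac1{U(t)}\int_0^t\left(\int_s^\infty h(z)\,dz\right)^pu(s)\,ds\right)^{\frac1p}\le c\int_0^\infty h(z)v(z)\,dz. \qquad ( * )$$ (i) Let $0<p<1$. Then $( * )$ holds for every $h\in\mathcal M^+(0,\infty)$ (with some finite constant $c$ independent of $h$) if and only if $$I_5:=\sup_{x\in(0,\infty)}\left(\operatorname*{ess\,sup}_{s\in(0,\infty)}w(s)\,\mathcal U(x,s)^{\frac1p}\right)\left(\int_{[0,\infty)}\mathcal U(t,x)^{\frac{p^*}{p}}\,d\left(-\underline v(t-,\infty)^{p^*}\right)\right)^{\frac1{p^*}}<\infty .$$ Moreover, the best constant $c$ in $( * )$ satisfies $c\approx I_5$. (ii) Let $1\le p<\infty$. Then $( * )$ holds for every $h\in\mathcal M^+(0,\infty)$ (with some finite constant $c$ independent of $h$) if and only if $$I_6:=\sup_{x\in(0,\infty)}\left(\operatorname*{ess\,sup}_{s\in(0,\infty)}w(s)\,\mathcal U(x,s)^{\frac1p}\right)U(x)^{-\frac1p}\sup_{t\in(0,x)}U(t)^{\frac1p}\,\underline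 v(t,\infty)<\infty .$$ Moreover, the best constant $c$ in $( * )$ satisfies $c\approx I_6$.
   Context: A weight is a locally integrable non-negative function on $(0,\infty)$; $\mathcal M^+(0,\infty)$ is the set of non-negative measurable functions on $(0,\infty)$. Put $U(t)=\int_0^t u(s)\,ds$, with $U(t)>0$ for all $t>0$, and $\mathcal U(x,t)=\dfrac{U(x)}{U(t)+U(x)}$. $U$ is admissible if it is continuous and strictly increasing on $[0,\infty)$, $U(0)=0$ and $\lim_{t\to\infty}U(t)=\infty$. A function $\varphi$ is non-degenerate with respect to $U^{1/p}$ if $$\lim_{t\to0+}\varphi(t)=\lim_{t\to\infty}\frac1{\varphi(t)}=\lim_{t\to\infty}\frac{\varphi(t)}{U(t)^{1/p}}=\lim_{t\to0+}\frac{U(t)^{1/p}}{\varphi(t)}=0 .$$ For $0\le a<b\le\infty$, $\underline v(a,b)=\operatorname{ess\,sup}_{s\in(a,b)}v(s)^{-1}$, and $\underline v(t-,\infty)=\lim_{s\to t-}\underline v(s,\infty)$. For $p\in(0,1)$, $p^*=\frac{p}{1-p}$. $d(-\underline v(t-,\infty)^{p^*})$ denotes the Lebesgue–Stieltjes (Borel) measure generated by the non-decreasing function $t\mapsto-\underline v(t-,\infty)^{p^*}$, i.e. the measure giving $[\alpha,\beta)$, $0<\alpha<\beta<\infty$, the mass $\underline v(\alpha-,\infty)^{p^*}-\underline v(\beta-,\infty)^{p^*}$; the integrand $\mathcal U(t,x)^{p^*/p}$ vanishes at $t=0$, so the integral over $[0,\infty)$ equals that over $(0,\infty)$. If $\underline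 v(t,\infty)=\infty$ for some $t>0$, this integral is understood as $+\infty$. Conventions: $1/0=\infty$, $1/\infty=0$, $0\cdot\infty=0$, $0/0=0$, $\infty/\infty=0$. $a\approx b$ means $\lambda^{-1}a\le b\le\lambda a$ with $\lambda>0$ depending only on inessential parameters (here the exponent $p$). *)

(* Defs.v *)
From HB Require Import structures.
From mathcomp Require Import all_boot all_order all_algebra.
From mathcomp Require Import all_classical all_reals all_analysis.
From mathcomp Require Import measurable_realfun ess_sup_inf.

Set Implicit Arguments.
Unset Strict Implicit.
Unset Printing Implicit Defensive.

Import Order.TTheory GRing.Theory Num.Theory.
Import numFieldNormedType.Exports.

Local Open Scope classical_set_scope.
Local Open Scope ring_scope.

Section weights.
Context {R : realType}.
Local Notation mu := (@lebesgue_measure R).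
Implicit Types (u v w : R -> R) (i : interval R) (p t x : R).

Definition weight w :=
  locally_integrable `]0, +oo[ w /\ forall t, 0 < t -> 0 <= w t.

Definition ess_sup_itv i (f : R -> \bar R) : \bar R :=
  ess_sup (mrestr mu (measurable_itv i)) f.

(* [Rintegral] is 0 when the integral is infinite: if u is not integrable near 0
   then primitive u is constantly 0, which [admissible] rules out. *)
Definition primitive u t : R := \int[mu]_(s in `]0, t[) u s.

Definition admissible (U : R -> R) :=
  [/\ {within `[0, +oo[, continuous U},
      {in `[0, +oo[ &, {homo U : x y / x < y}},
      U 0 = 0 &
      U t @[t --> +oo] --> +oo].

Definition cal (U : R -> R) x t : R := U x / (U t + U x).

(* Extended-real division has 1/0 = +oo, 1/+oo = 0, 0 * +oo = 0, 0/0 = 0 and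
   +oo/+oo = 0. *)
Definition nondegenerate_wrt (f : R -> \bar R) (rho : R -> R) :=
  [/\ f t @[t --> 0^'+] --> 0%E,
      ((f t)^-1)%E @[t --> +oo] --> 0%E,
      (f t / (rho t)%:E)%E @[t --> +oo] --> 0%E &
      ((rho t)%:E / f t)%E @[t --> 0^'+] --> 0%E].

Definition vbar v i : \bar R := ess_sup_itv i (fun s => ((v s)%:E^-1)%E).

Definition vbar_left v t : \bar R := lim (vbar v `]s, +oo[ @[s --> t^'-]).

Definition pstar p : R := p / (1 - p).

Definition phi_uw p u w t : \bar R :=
  (ess_sup_itv `]0%R, t[ (fun s =>
     (primitive u s `^ p^-1)%:E *
     ess_sup_itv `]s, +oo[ (fun tau =>
       (w tau)%:E / (primitive u tau `^ p^-1)%:E)))%E.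

End weights.

(* The Borel measure d(-G) on (0, +oo), for G finite, non-increasing and
   left-continuous on (0, +oo) (possibly unbounded near 0). As s |-> G (e^(-s))
   is non-decreasing and right-continuous on the whole line, d(-G) is the image
   of its Lebesgue-Stieltjes measure under s |-> e^(-s). *)
Section stieltjes.
Context {R : realType}.
Implicit Types G : R -> \bar R.

Definition dec_lcont G :=
  [/\ forall t, 0 < t -> G t \is a fin_num,
      {in `]0, +oo[ &, {homo G : x y / x <= y >-> (y <= x)%E}} &
      forall t, 0 < t -> G s @[s --> t^'-] --> G t].

Definition stieltjes_fun G (s : R) : R :=
  if `[< dec_lcont G >] then fine (G (expR (- s))) else 0.

Lemma stieltjes_fun_nd G : nondecreasing (stieltjes_fun G).
Proof.
move=> x y xy; rewrite /stieltjes_fun; case: asboolP => // -[Gf Gn _].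
have pos (s : R) : 0 < expR (- s) by exact: expR_gt0.
rewrite fine_le ?Gf ?pos//; apply: Gn; rewrite ?in_itv/= ?pos//.
by rewrite ler_expR lerN2.
Qed.

Lemma stieltjes_fun_rc G : right_continuous (stieltjes_fun G).
Proof.
move=> x; rewrite /stieltjes_fun; case: asboolP => [[Gf Gn Gl]|_]; last first.
  exact: cvg_cst.
have pos (s : R) : 0 < expR (- s) by exact: expR_gt0.
apply: fine_cvg; rewrite fineK ?Gf ?pos//.
have h : expR (- s) @[s --> x^'+] --> (expR (- x))^'-.
  have c : {for x, continuous (fun s : R => expR (- s))}.
    by apply: continuous_comp; [exact: opp_continuous | exact: continuous_expR].
  move=> A hA.
  have {}hA : \forall s \near x, expR (- s) < expR (- x) -> A (expR (- s)).
    exact: (c _ hA).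
  change (\forall s \near x, x < s -> A (expR (- s))).
  by apply: filterS hA => s + xs; apply; rewrite ltr_expR ltrN2.
by apply: (cvg_comp _ _ h); exact: Gl.
Qed.

HB.instance Definition _ G := isCumulative.Build R _ R (stieltjes_fun G)
  (@stieltjes_fun_nd G) (@stieltjes_fun_rc G).

Definition expRN (s : R) : R := expR (- s).

Lemma measurable_expRN : measurable_fun [set: R] expRN.
Proof. by apply: measurableT_comp => //; exact: measurable_expR. Qed.

Definition dneg G : set R -> \bar R :=
  pushforward (lebesgue_stieltjes_measure (stieltjes_fun G)) expRN.

Let mE (A : set R) : measurable A ->
  measurable (expRN @^-1` A : set (measurableTypeR R)).
Proof.
by move=> mA; rewrite -[X in measurable X]setTI; exact: measurable_expRN.
Qed.

Let dneg0 G : dneg G set0 = 0%E.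
Proof. by rewrite /dneg /pushforward preimage_set0 measure0. Qed.

Let dneg_ge0 G A : (0 <= dneg G A)%E.
Proof. by rewrite /dneg /pushforward; apply: measure_ge0. Qed.

Let dneg_sigma_additive G : semi_sigma_additive (dneg G).
Proof.
move=> F mF tF mUF; rewrite /dneg /pushforward preimage_bigcup.
apply: measure_semi_sigma_additive.
- by move=> n; apply: mE; exact: mF.
- apply/trivIsetP => /= i j _ _ ij; rewrite -preimage_setI.
  by move/trivIsetP : tF => /(_ _ _ _ _ ij) ->//; rewrite preimage_set0.
- by rewrite -preimage_bigcup; exact: mE.
Qed.

HB.instance Definition _ G := isMeasure.Build _ _ _ (dneg G)
  (dneg0 G) (dneg_ge0 G) (@dneg_sigma_additive G).

Lemma dneg_itv G (a b : R) : dec_lcont G -> 0 < a -> a < b ->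
  dneg G `[a, b[ = (G a - G b)%E.
Proof.
move=> GP a0 ab; have b0 := lt_trans a0 ab.
rewrite /dneg /pushforward.
have -> : expRN @^-1` `[a, b[ = `](- ln b), (- ln a)]%classic.
  apply/seteqP; split => s /=; rewrite !in_itv/=.
    move=> /andP[]; rewrite -{1}(lnK a0) ler_expR lerNr => ->.
    by rewrite -{1}(lnK b0) ltr_expR ltrNl => ->.
  move=> /andP[]; rewrite ltrNl lerNr => h1 h2.
  by rewrite -{1}(lnK a0) -{1}(lnK b0) ler_expR ltr_expR h1 h2.
rewrite /lebesgue_stieltjes_measure/= /measure_extension/=.
rewrite measurable_mu_extE//; last exact: is_ocitv.
rewrite /= wlength_itv_bnd ?lerN2 ?ler_ln ?posrE ?(ltW ab)//.
rewrite /stieltjes_fun; case: asboolP => // -[Gf _ _].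
by rewrite !opprK !lnK// EFinB !fineK ?Gf.
Qed.

Lemma dneg_le0 G : dneg G `]-oo, 0%R] = 0%E.
Proof.
rewrite /dneg /pushforward (_ : _ @^-1` _ = set0) ?measure0//.
by apply/seteqP; split => s //=; rewrite in_itv/= leNgt /expRN expR_gt0.
Qed.

End stieltjes.

Section vbar_stieltjes.
Context {R : realType}.
Local Notation mu := (@lebesgue_measure R).
Implicit Types (v : R -> R) (q s t : R).

Let vbar_ge0 v t : weight v -> 0 <= t -> (0 <= vbar v `]t, +oo[)%E.
Proof.
move=> [_ v0] t0; apply: ess_sup_gee.
  rewrite /= /mrestr setTI lebesgue_measure_itv/= ltry.
  by rewrite EFinN ltry.
exists (~` `]t, +oo[); split.
- exact: measurableC.
- change (mu (~` `]t, +oo[ `&` `]t, +oo[) = 0%E).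
  by rewrite setICl measure0.
- move=> s /= vs ts; apply: vs; rewrite inve_ge0 lee_fin; apply: v0.
  by move: ts; rewrite in_itv/= andbT; exact: le_lt_trans.
Qed.

Let vbar_nincr v :
  {homo (fun t => vbar v `]t, +oo[) : s t / s <= t >-> (t <= s)%E}.
Proof.
move=> s t st; rewrite /vbar /ess_sup_itv /ess_sup.
apply: ereal_inf_le_tmp => y /= [N [mN N0 sN]]; exists N; split => //.
apply/eqP; rewrite eq_le measure_ge0 andbT -N0; apply: le_measure.
- by rewrite inE; apply: measurableI.
- by rewrite inE; apply: measurableI.
- apply: setIS => x /=; rewrite !in_itv/= !andbT; exact: le_lt_trans.
Qed.

Let cvg_vbar v t :
  vbar v `]s, +oo[ @[s --> t^'-] -->
  ereal_inf [set vbar v `]s, +oo[ | s in `]-oo, t[].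
Proof.
apply/cvg_at_leftNP.
have : {in `](- t)%R, +oo[ &, {homo (fun s => vbar v `](- s)%R, +oo[) :
    x y / x <= y >-> (x <= y)%E}}.
  by move=> x y _ _ xy; apply: vbar_nincr; rewrite lerN2.
move=> /(@nondecreasing_at_right_cvge _ _ (- t) (BInfty _ false) isT).
move=> h; apply: (cvg_trans h); rewrite [X in nbhs (ereal_inf X)](_ : _ =
  [set vbar v `]s, +oo[ | s in `]-oo, t[])//.
apply/seteqP; split => _ [s /= + <-]; rewrite in_itv/= => st; exists (- s);
  rewrite ?in_itv/= ?opprK//; first by rewrite ltrNl; move: st; rewrite andbT.
by rewrite ltrN2 st.
Qed.

Let vbar_leftE v t :
  vbar_left v t = ereal_inf [set vbar v `]s, +oo[ | s in `]-oo, t[].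
Proof. by apply: cvg_lim => //; exact: cvg_vbar. Qed.

Let vbar_left_ge0 v t : weight v -> 0 < t -> (0 <= vbar_left v t)%E.
Proof.
move=> wv t0; rewrite vbar_leftE; apply: le_ereal_inf_tmp => _ [s /= _ <-].
have /le_trans : (0 <= vbar v `](Num.max 0 s)%R, +oo[)%E.
  by apply: vbar_ge0 => //; rewrite le_max lexx.
by apply; apply: vbar_nincr; rewrite le_max lexx orbT.
Qed.

Let vbar_left_nincr v : {homo vbar_left v : s t / s <= t >-> (t <= s)%E}.
Proof.
move=> s t st; rewrite !vbar_leftE; apply: ereal_inf_le_tmp.
by apply: image_subset => x /=; rewrite !in_itv/= => /lt_le_trans; exact.
Qed.

Let vbar_left_le v s t : s < t -> (vbar_left v t <= vbar v `]s, +oo[)%E.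
Proof.
by move=> st; rewrite vbar_leftE; apply: ereal_inf_lbound; exists s => //=.
Qed.

Let vbar_left_lcont v t : vbar_left v s @[s --> t^'-] --> vbar_left v t.
Proof.
apply/cvg_at_leftNP.
have : {in `](- t)%R, +oo[ &, {homo (fun s => vbar_left v (- s)) :
    x y / x <= y >-> (x <= y)%E}}.
  by move=> x y _ _ xy; apply: vbar_left_nincr; rewrite lerN2.
move=> /(@nondecreasing_at_right_cvge _ _ (- t) (BInfty _ false) isT).
move=> h; apply: (cvg_trans h); rewrite [X in nbhs X](_ : _ = vbar_left v t)//.
apply/eqP; rewrite eq_le; apply/andP; split.
  rewrite [leRHS]vbar_leftE; apply: le_ereal_inf_tmp => _ [s /= + <-].
  rewrite in_itv/= => st; apply: ge_ereal_inf.
  exists (vbar_left v ((s + t) / 2)); last first.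
    by apply: vbar_left_le; rewrite midf_lt.
  by exists (- ((s + t) / 2)); rewrite ?opprK//= in_itv/= andbT ltrN2 midf_lt.
apply: le_ereal_inf_tmp => _ [s /= + <-]; rewrite in_itv/= andbT => st.
by apply: vbar_left_nincr; rewrite lerNl ltW.
Qed.

Let cvg_powR {T : Type} (F : set_system T) {FF : Filter F} (f : T -> R)
    (l q : R) :
  0 < q -> (\forall x \near F, 0 <= f x) -> 0 <= l ->
  f x @[x --> F] --> l -> f x `^ q @[x --> F] --> l `^ q.
Proof.
move=> q0 f0; rewrite le_eqVlt => /predU1P[<- fl|l0 fl]; last first.
  apply: (@cvg_comp _ _ _ f (@powR R ^~ q)) fl _.
  have : derivable (@powR R ^~ q) l 1.
    by apply: derivable_powR; rewrite in_itv/= l0.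
  by move=> /derivable1_diffP/differentiable_continuous.
rewrite powR0 ?gt_eqF//; apply/cvgr0Pnorm_lt => e e0.
have e1 : 0 < e `^ q^-1 by rewrite powR_gt0.
move/cvgr0Pnorm_lt : fl => /(_ _ e1); apply: filterS2 f0 => x fx0.
rewrite ger0_norm// ger0_norm ?powR_ge0// => fxe.
rewrite -[ltRHS]powRr1 ?(ltW e0)// -(mulVf (lt0r_neq0 q0)) powRrM.
by apply: gt0_ltr_powR; rewrite // nnegrE powR_ge0.
Qed.

Lemma dec_lcont_vbar v q : weight v -> 0 < q ->
  (forall t, 0 < t -> (vbar v `]t, +oo[ < +oo)%E) ->
  dec_lcont (fun t => vbar_left v t `^ q)%E.
Proof.
move=> wv q0 fin.
have ffin t : 0 < t -> vbar_left v t \is a fin_num.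
  move=> t0; rewrite ge0_fin_numE ?vbar_left_ge0//.
  apply: (@le_lt_trans _ _ (vbar v `](t / 2)%R, +oo[)); last first.
    by apply: fin; rewrite divr_gt0.
  by apply: vbar_left_le; rewrite ltr_pdivrMr// ltr_pMr// ltr1n.
split.
- by move=> t t0; rewrite fin_num_poweR// ffin.
- move=> x y; rewrite !in_itv/= !andbT => x0 y0 xy.
  apply: gt0_ler_poweR; rewrite ?(ltW q0)// ?in_itv/= ?leey ?vbar_left_ge0//.
  exact: vbar_left_nincr.
- move=> t t0; rewrite -(fineK (ffin _ t0)) poweR_EFin.
  have pos : \forall s \near t^'-, 0 < s by exact: nbhs_left_gt.
  apply: (@cvg_trans _ ((fine (vbar_left v s) `^ q)%:E @[s --> t^'-])).
    apply: near_eq_cvg; apply: filterS pos => s s0.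
    by rewrite -poweR_EFin fineK ?ffin.
  apply: cvg_EFin; first exact: nearW.
  apply: cvg_powR => //.
  + by apply: filterS pos => s s0; apply: fine_ge0; exact: vbar_left_ge0.
  + by apply: fine_ge0; exact: vbar_left_ge0.
  + by apply: fine_cvg; rewrite fineK ?ffin//; exact: vbar_left_lcont.
Qed.

End vbar_stieltjes.

Section inequality.
Context {R : realType}.
Local Notation mu := (@lebesgue_measure R).
Local Open Scope ereal_scope.
Implicit Types (u v w : R -> R) (p q c : R).

(* The integral over [0, +oo) against d(-(vbar(t-, +oo)^q)); [dec_lcont_vbar]
   shows that in the second case [dneg] is applied within its domain. *)
Definition vbar_integral v q (f : R -> \bar R) : \bar R :=
  if `[< exists2 t : R, (0 < t)%R & vbar v `]t, +oo[ = +oo >] then +oo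
  else \int[dneg (fun t => vbar_left v t `^ q)]_(t in `[0%R, +oo[) f t.

Definition inequality p u v w c :=
  forall h : R -> \bar R,
    measurable_fun (`]0%R, +oo[ : set R) h ->
    (forall t : R, (0 < t)%R -> 0 <= h t) ->
    ess_sup_itv `]0%R, +oo[ (fun t =>
      (w t)%:E * ((primitive u t)%:E^-1 *
        \int[mu]_(s in `]0%R, t[)
          ((\int[mu]_(z in `]s, +oo[) h z) `^ p * (u s)%:E)) `^ p^-1)
    <= c%:E * \int[mu]_(z in `]0%R, +oo[) (h z * (v z)%:E).

Definition best_constant p u v w : \bar R :=
  ereal_inf [set c%:E | c in [set c : R | (0 <= c)%R /\ inequality p u v w c]].

Definition wU p u w x : \bar R :=
  ess_sup_itv `]0%R, +oo[ (fun s =>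
    (w s)%:E * (cal (primitive u) x s `^ p^-1)%:E).

Definition I5 p u v w : \bar R :=
  ereal_sup [set wU p u w x *
      vbar_integral v (pstar p)
        (fun t => (cal (primitive u) t x `^ (pstar p / p))%:E)
      `^ (pstar p)^-1
    | x in `]0%R, +oo[].

Definition I6 p u v w : \bar R :=
  ereal_sup [set wU p u w x * (primitive u x `^ (- p^-1))%:E *
      ereal_sup [set (primitive u t `^ p^-1)%:E * vbar v `]t, +oo[
                | t in `]0%R, x[]
    | x in `]0%R, +oo[].

End inequality.

(* Main.v *)
Require Import Defs.
From HB Require Import structures.
From mathcomp Require Import all_boot all_order all_algebra.
From mathcomp Require Import all_classical all_reals all_analysis.
From mathcomp Require Import measurable_realfun ess_sup_inf.
From mathcomp Require Import ring lra.

Set Implicit Arguments.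
Unset Strict Implicit.
Unset Printing Implicit Defensive.

Import Order.TTheory GRing.Theory Num.Theory.
Import numFieldNormedType.Exports.

Local Open Scope classical_set_scope.
Local Open Scope ring_scope.

(* Write U for the primitive of u, H(s) for the integral of h over (s, oo),
   A_h(x) = ((1/U(x)) int_0^x H^p u)^(1/p) and
   W(x) = ess sup_s w(s) cal(x, s)^(1/p). As H is non-increasing, the average of
   H^p u over (0, t) is non-increasing in t while the integral is non-decreasing;
   hence, up to a constant depending only on p, ess sup_t w(t) A_h(t) equals
   sup_x W(x) A_h(x), and the problem reduces to the best constant in
   A_h(x) <= C int h v for a fixed x.
   Discretise by points y_k with U(y_k) = U(x) / 2^k and put
   b_k = vbar(y_(k+1), oo). Then A_h(x)^p <= sum_k 2^-k H(y_(k+1))^p.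
   - For p >= 1 the p-th root of this is at most sum_k 2^(-k/p) H(y_(k+1)), i.e.
     the integral of h against a staircase function, which is compared with v.
   - For p < 1, with q = p* and theta_k = max_(j <= k) b_j / 2^j, Hoelder's
     inequality with weights theta_k bounds it in terms of int h v and
     sum_k 2^(-k q/p) b_k^q, and this sum is comparable to the Stieltjes
     integral of cal(., x)^(q/p) against d(- vbar(t-, oo)^q).
   For necessity, test the inequality on combinations of normalised indicators
   of sets E_k in (y_(k+1), oo) on which v is close to 1 / b_k. *)

(** * Essential suprema over intervals, read as almost-everywhere bounds, and positivity of
    [vbar] *)

Section ess_sup_itv.
Context {R : realType}.
Local Notation mu := (@lebesgue_measure R).
Local Open Scope ereal_scope.
Implicit Types (i : interval R) (f : R -> \bar R) (v : R -> R).

Lemma ae_imply (P Q : R -> Prop) : (forall x, P x -> Q x) ->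
  {ae mu, forall x, P x} -> {ae mu, forall x, Q x}.
Proof.
move=> PQ; apply: negligibleS => x /= nQ Px; apply: nQ; exact: PQ.
Qed.

(** A set is null for the restricted measure when its trace on the interval is null, so exceptional
    sets pass from one side to the other by intersecting with [i] or by adjoining its complement. *)
Lemma ess_sup_itvP i f y :
  ess_sup_itv i f <= y <-> {ae mu, forall x, x \in i -> f x <= y}.
Proof.
rewrite /ess_sup_itv; split.
  move=> /ess_supP h. case: h => N [mN N0 sN]; exists (N `&` [set` i]); split.
  - by apply: measurableI.
  - exact: N0.
  - move=> x /= xN; split; last by apply: contrapT => xi; apply: xN.
    by apply: sN => /= fxy; apply: xN.
move=> [N [mN N0 sN]]; apply/ess_supP; exists (N `|` ~` [set` i]); split.
- by apply: measurableU => //; apply: measurableC.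
- change (mu ((N `|` ~` [set` i]) `&` [set` i]) = 0).
  rewrite setIUl setICl setU0; apply/eqP; rewrite -measure_le0 -N0.
  apply: le_measure; rewrite ?inE; last exact: subIsetl.
    exact: measurableI.
  exact: mN.
- move=> x /= fxy; have [xi|xi] := boolP (x \in i); last by right; exact/negP.
  by left; apply: sN => /= /(_ xi).
Qed.

Lemma ess_sup_itv_ge i f :
  {ae mu, forall x, x \in i -> f x <= ess_sup_itv i f}.
Proof. exact/ess_sup_itvP. Qed.

Lemma ae_itv_ex i (P : R -> Prop) : 0 < mu [set` i] ->
  {ae mu, forall x, x \in i -> P x} -> exists2 x, x \in i & P x.
Proof.
move=> i0 [N [mN N0 sN]]; apply: contrapT => h.
have : mu [set` i] <= mu N.
  apply: le_measure; rewrite ?inE//; apply: subset_trans sN => x /= xi.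
  by move=> /(_ xi) Px; apply: h; exists x.
by rewrite N0 leNgt i0.
Qed.

Lemma lebesgue_measure_ray (a : R) : mu `]a, +oo[ = +oo.
Proof. by rewrite lebesgue_measure_itv/= ltry. Qed.

Lemma ess_sup_itv_ge0 i f : 0 < mu [set` i] ->
  (forall x, x \in i -> 0 <= f x) -> 0 <= ess_sup_itv i f.
Proof.
move=> i0 f0; have [x xi fx] := ae_itv_ex i0 (ess_sup_itv_ge i f).
exact: le_trans (f0 _ xi) fx.
Qed.

(** For [a = 0] the left-hand side is 0 even if the essential supremum is infinite, by the
    convention on 0 times infinity; for [a > 0] the factor can be divided out. *)
Lemma ess_sup_itvZ_le i f (a y : R) : (0 <= a)%R -> (0 <= y)%R ->
  (forall x, x \in i -> 0 <= f x) ->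
  {ae mu, forall x, x \in i -> f x * a%:E <= y%:E} ->
  ess_sup_itv i f * a%:E <= y%:E.
Proof.
move=> a0 y0 f0; have [->|an0] := eqVneq a 0%R; first by rewrite mule0 lee_fin.
have {an0}a0 : (0 < a)%R by rewrite lt0r an0.
move=> fay; rewrite -lee_pdivlMr// -EFinM; apply/ess_sup_itvP.
apply: ae_imply fay => x h xi; rewrite EFinM lee_pdivlMr//; exact: h.
Qed.

Lemma vbar_nonincreasing v :
  {homo (fun t => vbar v `]t, +oo[) : s t / (s <= t)%R >-> t <= s}.
Proof.
move=> s t st; apply/ess_sup_itvP.
apply: ae_imply (ess_sup_itv_ge `]s, +oo[ (fun s => (v s)%:E^-1)) => x h xt.
apply: h; move: xt; rewrite !in_itv/= !andbT; exact: le_lt_trans.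
Qed.

(** The inverse of the finite number [v x] never vanishes, and the ray has positive measure, so it
    contains a point at which the almost-everywhere bound holds. *)
Lemma vbar_gt0 v t : weight v -> (0 <= t)%R -> 0 < vbar v `]t, +oo[.
Proof.
move=> [_ v0] t0; have tr0 : 0 < mu `]t, +oo[ by rewrite lebesgue_measure_ray.
have [x xt] := ae_itv_ex tr0 (ess_sup_itv_ge _ (fun s => (v s)%:E^-1)).
apply: lt_le_trans.
have : (0 <= v x)%R.
  by apply: v0; move: xt; rewrite in_itv/= andbT; exact: le_lt_trans.
by move=> vx0; rewrite lt0e inve_ge0 lee_fin vx0 inve_eq0.
Qed.

(** The lower bound on [v] used by the staircase estimates. A point with [v x = 0] has inverse +oo,
    which finiteness of [vbar] excludes. *)
Lemma vbar_ae v t : weight v -> (0 <= t)%R -> (vbar v `]t, +oo[ < +oo) ->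
  {ae mu, forall s, (t < s)%R -> ((fine (vbar v `]t, +oo[))^-1 <= v s)%R}.
Proof.
move=> wv t0 vy; have vb0 := vbar_gt0 wv t0.
apply: ae_imply (ess_sup_itv_ge `]t, +oo[ (fun s => (v s)%:E^-1)).
move=> x h tx; have : ((v x)%:E^-1 <= vbar v `]t, +oo[).
  by apply: h; rewrite in_itv/= tx.
have vx0 : (0 <= v x)%R by apply: wv.2; exact: le_lt_trans tx.
rewrite -[in X in X -> _](@fineK _ (vbar v _)) ?ge0_fin_numE ?(ltW vb0)//.
have f0 : (0 < fine (vbar v `]t, +oo[))%R by rewrite fine_gt0// vb0.
move: vx0; rewrite le_eqVlt => /predU1P[<-|vx0].
  by rewrite inve0 leye_eq.
by rewrite inver gt_eqF// lee_fin -[leRHS]invrK lef_pV2 ?posrE ?invr_gt0.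
Qed.

End ess_sup_itv.

(** * The primitive of a weight and averages of non-increasing functions *)

Section primitive.
Context {R : realType} (u : R -> R).
Local Notation mu := (@lebesgue_measure R).
Local Notation U := (primitive u).
Hypotheses (wu : weight u) (U_gt0 : forall t, 0 < t -> 0 < U t)
  (aU : admissible U).

Lemma weight_measurable (w : R -> R) : weight w ->
  measurable_fun (`]0, +oo[ : set R) w.
Proof. by move=> [[]]. Qed.

(** [primitive] returns 0 on an infinite integral, so positivity of U forces the integral to be
    finite. *)
Lemma primitiveE t : 0 < t -> (\int[mu]_(s in `]0%R, t[) (u s)%:E)%E = (U t)%:E.
Proof.
move=> t0; have := U_gt0 t0; rewrite /primitive /Rintegral.
by case: (integral _ _ _) => //=; rewrite ltxx.
Qed.

Lemma primitive_lt x y : 0 <= x -> x < y -> U x < U y.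
Proof.
move=> x0 xy; case: aU => _ + _ _; apply => //; rewrite in_itv/= andbT//.
by rewrite (le_trans x0)// ltW.
Qed.

Lemma primitive_le x y : 0 <= x -> x <= y -> U x <= U y.
Proof.
move=> x0; rewrite le_eqVlt => /predU1P[->//|xy].
by rewrite ltW// primitive_lt.
Qed.

Lemma primitive_lt_inv x y : 0 <= y -> U x < U y -> x < y.
Proof. by move=> y0; apply: contraTT; rewrite -!leNgt; exact: primitive_le. Qed.

Lemma primitive_ivt a b c : 0 <= a -> a <= b -> U a <= c <= U b ->
  exists2 y, a <= y <= b & U y = c.
Proof.
move=> a0 ab /andP[Uac cUb].
have [||y] := @IVT _ U a b c ab; last 2 first.
- by rewrite ge_min le_max Uac cUb orbT.
- by rewrite in_itv/= => yab <-; exists y.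
case: aU => + _ _ _; apply: continuous_subspaceW => z /=.
by rewrite !in_itv/= andbT => /andP[/(le_trans a0)].
Qed.

(** The dyadic points y_k of the discretisation, by the intermediate value theorem on [0, x]; y_k is
    not 0 because U(y_k) is positive. *)
Lemma primitive_grid x : 0 < x -> exists y : nat -> R,
  forall k, 0 < y k <= x /\ U (y k) = U x / 2 ^+ k.
Proof.
move=> x0; suff /choice[y hy] : forall k, exists y, 0 < y <= x /\ U y = U x / 2 ^+ k.
  by exists y.
move=> k; have U0 : U 0 = 0 by case: aU.
have c0 : 0 < U x / 2 ^+ k by rewrite divr_gt0 ?U_gt0 ?exprn_gt0.
have [||y /andP[y0 yx] Uy] := @primitive_ivt 0 x (U x / 2 ^+ k) (lexx _).
- exact: ltW.
- rewrite U0 (ltW c0)/= ler_pdivrMr ?exprn_gt0// ler_peMr ?(ltW (U_gt0 x0))//.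
  by rewrite exprn_ege1// ler1n.
- exists y; rewrite yx andbT lt0r y0 andbT; split => //.
  by apply: contraTneq c0 => y00; rewrite -Uy y00 U0 ltxx.
Qed.

(** The point is rational so that only countably many null sets occur when the bounds [wU] at all
    these points are used together; doubling U at most keeps the loss a constant factor. *)
Lemma primitive_double_rat t : 0 < t ->
  exists2 q : rat, t < ratr q & U (ratr q) <= 2 * U t.
Proof.
move=> t0; have [X tX UX] : exists2 X, t <= X & 2 * U t <= U X.
  case: aU => _ _ _ /cvgryPge/(_ (2 * U t)) [M [_ hM]].
  exists (Num.max t (M + 1)); first by rewrite le_max lexx.
  by apply: hM; rewrite lt_max ltrDl ltr01 orbT.
have Ut : U t < 2 * U t by have := U_gt0 t0; lra.
have [|y /andP[ty yX] Uy] := @primitive_ivt t X (2 * U t) (ltW t0) tX.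
  by rewrite (ltW Ut).
have {}ty : t < y by apply: primitive_lt_inv; [exact: le_trans (ltW t0) ty|rewrite Uy].
have [q] := rat_in_itvoo ty; rewrite in_itv/= => /andP[tq qy].
exists q => //; rewrite -Uy; apply: primitive_le; last exact: ltW.
by rewrite ltW// (lt_trans t0).
Qed.

End primitive.

(** * Integrals of [H^p u] over (0, t) for non-increasing [H] *)

Section weighted_integral.
Context {R : realType} (u : R -> R) (p : R).
Local Notation mu := (@lebesgue_measure R).
Local Notation U := (primitive u).
Hypotheses (wu : weight u) (U_gt0 : forall t, 0 < t -> 0 < U t)
  (aU : admissible U) (p_gt0 : 0 < p).
Local Open Scope ereal_scope.

Lemma measurable_weight_EFin (w : R -> R) : weight w ->
  measurable_fun (`]0%R, +oo[ : set R) (EFin \o w).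
Proof. by move=> ww; apply/measurable_EFinP; exact: weight_measurable. Qed.

Lemma integral_itv_split (f : R -> \bar R) s t : (0 < s <= t)%R ->
  measurable_fun (`]0%R, +oo[ : set R) f -> (forall x, (0 < x)%R -> 0 <= f x) ->
  \int[mu]_(x in `]0%R, t[) f x =
  \int[mu]_(x in `]0%R, s[) f x + \int[mu]_(x in `[s, t[) f x.
Proof.
move=> /andP[s0 st] mf f0.
have E : `]0%R, t[%classic = `]0%R, s[ `|` `[s, t[.
  apply/seteqP; split => x /=; rewrite !in_itv/=.
    move=> /andP[-> xt]; rewrite xt andbT.
    by have [|] := leP s x; [right|left].
  by move=> [/andP[-> /lt_le_trans ->]|/andP[/(lt_le_trans s0) -> ->]].
rewrite E ge0_integral_setU//.
- rewrite -E; apply: measurable_funS mf => // x /=.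
  by rewrite !in_itv/= => /andP[->].
- by move=> x; rewrite -E/= in_itv/= => /andP[x0 _]; exact: f0.
- apply/disj_setPS => x [] /=; rewrite !in_itv/= => /andP[_ xs] /andP[sx _].
  by move: (lt_le_trans xs sx); rewrite ltxx.
Qed.

Lemma primitive_itv s t : (0 < s <= t)%R ->
  \int[mu]_(x in `[s, t[) (u x)%:E = (U t - U s)%:E.
Proof.
move=> st; have /andP[s0 st'] := st.
have := integral_itv_split st (measurable_weight_EFin wu)
  (fun x x0 => wu.2 x x0).
rewrite !primitiveE// ?(lt_le_trans s0)//=.
set I := integral _ _ _ => h.
(* A finite sum of extended reals has finite terms, which makes the subtraction legitimate. *)
have : (U s)%:E + I \is a fin_num by rewrite -h.
rewrite fin_numD/= => /fineK Ie.
by move: h; rewrite -Ie -EFinD => -[->]; rewrite addrAC subrr add0r.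
Qed.

Definition weighted_integral (H : R -> \bar R) t : \bar R :=
  \int[mu]_(s in `]0%R, t[) (H s `^ p * (u s)%:E).

Variable H : R -> \bar R.
Hypotheses (H_ge0 : forall s, (0 < s)%R -> 0 <= H s)
  (H_ni : forall s t, (0 < s)%R -> (s <= t)%R -> H t <= H s).

(** The superlevel sets of a monotone function are intervals, and rays generate the Borel sets of
    the extended line. *)
Lemma measurable_nonincreasing : measurable_fun (`]0%R, +oo[ : set R) H.
Proof.
move=> mD; apply: (measurability _ (ErealGenCInfty.measurableE R)) => //.
move=> _ [_ [r ->] <-].
apply: is_interval_measurable => s t/=.
rewrite !in_itv/= !andbT => -[s0 rs] [t0 rt] x /andP[sx xt].
have x0 : (0 < x)%R by exact: lt_le_trans sx.
split; first by rewrite /= in_itv/= x0.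
by rewrite /= in_itv/= andbT (le_trans rt)// H_ni.
Qed.

Let F s := H s `^ p * (u s)%:E.

Lemma measurable_weighted : measurable_fun (`]0%R, +oo[ : set R) F.
Proof.
apply: (@emeasurable_funM _ _ _ _ (fun s => H s `^ p) (EFin \o u)).
  apply: (measurableT_comp (@measurable_poweR R p)).
  exact: measurable_nonincreasing.
exact: measurable_weight_EFin.
Qed.

Lemma weighted_ge0 s : (0 < s)%R -> 0 <= F s.
Proof. by move=> s0; rewrite mule_ge0 ?poweR_ge0// lee_fin; exact: wu.2. Qed.

Lemma weighted_integral_ge0 t : 0 <= weighted_integral H t.
Proof.
apply: integral_ge0 => s /=; rewrite in_itv/= => /andP[s0 _].
exact: weighted_ge0.
Qed.

Lemma le_poweR (x y : \bar R) (r : R) : (0 <= r)%R -> 0 <= x -> x <= y ->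
  x `^ r <= y `^ r.
Proof.
move=> r0 x0 xy; apply: gt0_ler_poweR => //; rewrite in_itv/= ?x0 ?leey//.
by rewrite (le_trans x0).
Qed.

Lemma weighted_integral_le_itv a b (m : \bar R) :
  measurable (`[a, b[ : set R) -> (0 < a)%R -> 0 <= m ->
  (forall r, (a <= r < b)%R -> H r <= m) ->
  \int[mu]_(s in `[a, b[) F s <= m `^ p * \int[mu]_(s in `[a, b[) (u s)%:E.
Proof.
move=> mab a0 m0 Hm.
have sub : `[a, b[ `<=` `]0%R, +oo[.
  by move=> x /=; rewrite !in_itv/= andbT => /andP[/(lt_le_trans a0)].
have mu' := measurable_funS _ sub (measurable_weight_EFin wu).
rewrite -ge0_integralZl ?poweR_ge0//; last 2 first.
- exact: mu'.
- move=> x /sub /=; rewrite in_itv/= andbT lee_fin; exact: wu.2.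
apply: ge0_le_integral => //.
- by move=> x /sub /=; rewrite in_itv/= andbT; exact: weighted_ge0.
- exact: measurable_funS measurable_weighted.
- by apply: emeasurable_funM => //; exact: mu'.
move=> x xab; have /= := sub _ xab; rewrite in_itv/= andbT => x0.
apply: lee_wpmul2r; first by rewrite lee_fin; exact: wu.2.
apply: le_poweR; rewrite ?(ltW p_gt0)//; first exact: H_ge0.
by apply: Hm; move: xab; rewrite /= in_itv.
Qed.

(** The bracket at [a] is left open in order to cover both [[s, t[], for a step of the grid, and
    []0, t[], for the whole integral. *)
Lemma weighted_integral_ge_itv b0 a b (m : \bar R) :
  (0 <= a)%R -> [set` Interval (BSide b0 a) (BLeft b)] `<=` `]0%R, +oo[ ->
  0 <= m -> (forall r, r \in Interval (BSide b0 a) (BLeft b) -> m <= H r) ->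
  m `^ p * \int[mu]_(s in [set` Interval (BSide b0 a) (BLeft b)]) (u s)%:E <=
  \int[mu]_(s in [set` Interval (BSide b0 a) (BLeft b)]) F s.
Proof.
move=> a0 sub m0 Hm.
have mu' := measurable_funS _ sub (measurable_weight_EFin wu).
rewrite -ge0_integralZl ?poweR_ge0//; last 2 first.
- exact: mu'.
- move=> x /sub /=; rewrite in_itv/= andbT lee_fin; exact: wu.2.
apply: ge0_le_integral => //.
- move=> x /sub /=; rewrite in_itv/= andbT => x0.
  by rewrite mule_ge0 ?poweR_ge0// lee_fin; exact: wu.2.
- by apply: emeasurable_funM => //; exact: mu'.
- exact: measurable_funS measurable_weighted.
move=> x xab; have /= := sub _ xab; rewrite in_itv/= andbT => x0.
apply: lee_wpmul2r; first by rewrite lee_fin; exact: wu.2.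
by apply: le_poweR; rewrite ?(ltW p_gt0)//; exact: Hm.
Qed.

Lemma weighted_integral_step_le s t m : (0 < s <= t)%R -> 0 <= m ->
  (forall r, (s <= r < t)%R -> H r <= m) ->
  weighted_integral H t <=
  weighted_integral H s + m `^ p * (U t - U s)%:E.
Proof.
move=> st m0 Hm; have /andP[s0 st'] := st.
rewrite /weighted_integral (integral_itv_split st measurable_weighted)//.
  by rewrite leeD2l// -primitive_itv//; exact: weighted_integral_le_itv.
exact: weighted_ge0.
Qed.

Lemma weighted_integral_step_ge s t m : (0 < s <= t)%R -> 0 <= m ->
  (forall r, (s <= r < t)%R -> m <= H r) ->
  weighted_integral H s + m `^ p * (U t - U s)%:E <=
  weighted_integral H t.
Proof.
move=> st m0 Hm; have /andP[s0 st'] := st.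
rewrite /weighted_integral (integral_itv_split st measurable_weighted)//.
  rewrite leeD2l// -primitive_itv//; apply: weighted_integral_ge_itv => //.
  - exact: ltW.
  - by move=> x /=; rewrite !in_itv/= andbT => /andP[/(lt_le_trans s0)].
exact: weighted_ge0.
Qed.

Lemma weighted_integral_ge t m : (0 < t)%R -> 0 <= m ->
  (forall r, (0 < r < t)%R -> m <= H r) ->
  m `^ p * (U t)%:E <= weighted_integral H t.
Proof.
move=> t0 m0 Hm; rewrite -primitiveE//; apply: weighted_integral_ge_itv => //.
by move=> x /=; rewrite !in_itv/= andbT => /andP[].
Qed.

Lemma weighted_integral_le s t : (0 < s <= t)%R ->
  weighted_integral H s <= weighted_integral H t.
Proof.
move=> st; apply: (le_trans _ (weighted_integral_step_ge st (lexx 0) _)).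
  by rewrite poweR0r ?gt_eqF// mul0e adde0.
by move=> r /andP[sr _]; apply: H_ge0; case/andP: st => /lt_le_trans + _; apply.
Qed.

(* For x <= t the integral is non-decreasing; for t <= x the average is
   non-increasing. The factor U t + U x, the denominator of [cal], covers both
   cases. *)
Lemma weighted_average_quasi_mono x t : (0 < x)%R -> (0 < t)%R ->
  weighted_integral H x * (U t)%:E <= weighted_integral H t * (U t + U x)%:E.
Proof.
move=> x0 t0; have Ux := U_gt0 x0; have Ut := U_gt0 t0.
have UU : (0 <= U t + U x)%R by rewrite addr_ge0// ltW.
have [xt|/ltW tx] := leP x t.
  apply: lee_pmul; rewrite ?weighted_integral_ge0// ?lee_fin ?(ltW Ut)//.
    by apply: weighted_integral_le; rewrite x0.
  by rewrite lerDl ltW.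
have Utx : (U t <= U x)%R by apply: primitive_le => //; exact: ltW.
have h1 : weighted_integral H x <=
    weighted_integral H t + H t `^ p * (U x - U t)%:E.
  apply: weighted_integral_step_le; rewrite ?t0 ?H_ge0// => r /andP[tr _].
  exact: H_ni.
have h2 : H t `^ p * (U t)%:E <= weighted_integral H t.
  apply: weighted_integral_ge; rewrite ?H_ge0// => r /andP[r0 /ltW rt].
  exact: H_ni.
apply: (@le_trans _ _
    ((weighted_integral H t + H t `^ p * (U x - U t)%:E) * (U t)%:E)).
  by apply: lee_wpmul2r h1; rewrite lee_fin ltW.
have W0 := weighted_integral_ge0 t.
rewrite ge0_muleDl ?mule_ge0 ?poweR_ge0// ?lee_fin ?subr_ge0//.
rewrite [(U t + U x)%:E]EFinD ge0_muleDr ?lee_fin ?(ltW Ut) ?(ltW Ux)//.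
rewrite leeD2l//.
rewrite muleAC; apply: (@le_trans _ _ (weighted_integral H t * (U x - U t)%:E)).
  by apply: lee_wpmul2r h2; rewrite lee_fin subr_ge0.
by apply: lee_wpmul2l => //; rewrite lee_fin gerBl ltW.
Qed.

End weighted_integral.

(** * Averages of [H^p u] and the passage from all t to a fixed x *)

Section average.
Context {R : realType} (u : R -> R) (p : R).
Local Notation mu := (@lebesgue_measure R).
Local Notation U := (primitive u).
Hypotheses (wu : weight u) (U_gt0 : forall t, 0 < t -> 0 < U t)
  (aU : admissible U) (p_gt0 : 0 < p).
Local Open Scope ereal_scope.

Definition average (H : R -> \bar R) t : \bar R :=
  (U t)%:E^-1 * weighted_integral u p H t.

Lemma averageE H t : (0 < t)%R ->
  average H t = ((U t)^-1)%:E * weighted_integral u p H t.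
Proof. by move=> t0; rewrite /average inver gt_eqF// U_gt0. Qed.

Lemma average_ge0 H t : (0 < t)%R -> 0 <= average H t.
Proof.
move=> t0; rewrite averageE// mule_ge0 ?weighted_integral_ge0//.
by rewrite lee_fin invr_ge0 ltW// U_gt0.
Qed.

Lemma cal_gt0 x t : (0 < x)%R -> (0 < t)%R -> (0 < cal U x t)%R.
Proof. by move=> x0 t0; rewrite divr_gt0 ?addr_gt0 ?U_gt0. Qed.

Variable H : R -> \bar R.
Hypotheses (H_ge0 : forall s, (0 < s)%R -> 0 <= H s)
  (H_ni : forall s t, (0 < s)%R -> (s <= t)%R -> H t <= H s).

(** This is [weighted_average_quasi_mono] divided by U(t) (U(t) + U(x)); the quotient U(x) / (U(t) +
    U(x)) that appears is [cal]. *)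
Lemma average_quasi_mono x t : (0 < x)%R -> (0 < t)%R ->
  (cal U x t)%:E * average H x <= average H t.
Proof.
move=> x0 t0; have Ux := U_gt0 x0; have Ut := U_gt0 t0.
have UU : (0 < U t + U x)%R by rewrite addr_gt0.
have c0 : (0 <= (U t * (U t + U x))^-1)%R.
  by rewrite invr_ge0 ltW// mulr_gt0.
rewrite !averageE// muleA -EFinM.
have -> : (cal U x t / U x = (U t * (U t + U x))^-1 * U t)%R.
  by rewrite /cal; field; rewrite !gt_eqF.
have -> : ((U t)^-1 = (U t * (U t + U x))^-1 * (U t + U x))%R.
  by field; rewrite !gt_eqF.
rewrite !EFinM -!muleA; apply: lee_wpmul2l; first by rewrite lee_fin.
by rewrite muleC [leRHS]muleC; exact: weighted_average_quasi_mono.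
Qed.

(** The half of the reduction used for necessity: by [average_quasi_mono] the average at every t
    dominates [cal] times [a]. The real number [a] stands in for the average at x, which may be
    infinite. *)
Lemma wU_average_le (w : R -> R) x a C : weight w -> (0 < x)%R -> (0 <= a)%R ->
  (0 <= C)%R -> a%:E <= average H x ->
  ess_sup_itv `]0%R, +oo[ (fun t => (w t)%:E * average H t `^ p^-1) <= C%:E ->
  wU p u w x * (a `^ p^-1)%:E <= C%:E.
Proof.
move=> ww x0 a0 C0 ax /ess_sup_itvP wH; apply: ess_sup_itvZ_le => //.
- exact: powR_ge0.
- move=> t; rewrite in_itv/= andbT => t0.
  by rewrite mule_ge0 ?lee_fin ?powR_ge0//; exact: ww.2.
apply: ae_imply wH => t ht t0; apply: le_trans (ht t0).
move: t0; rewrite in_itv/= andbT => t0.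
rewrite -muleA; apply: lee_wpmul2l; first by rewrite lee_fin; exact: ww.2.
have k0 := cal_gt0 x0 t0.
rewrite -EFinM -powRM ?(ltW k0)// -poweR_EFin.
apply: le_poweR; rewrite ?lee_fin ?invr_ge0 ?(ltW p_gt0)//.
  by rewrite mulr_ge0// ltW.
apply: le_trans (average_quasi_mono x0 t0).
by rewrite EFinM; apply: lee_wpmul2l => //; rewrite lee_fin ltW.
Qed.

(** The half used for sufficiency. Given t, take x > t rational with U(x) <= 2 U(t). Then cal(x, t)
    >= 1/2 and the average at t is at most twice that at x; these two factors 2 make the 4. *)
Lemma average_wU_le (w : R -> R) C : weight w -> (0 <= C)%R ->
  (forall x, (0 < x)%R -> wU p u w x * average H x `^ p^-1 <= C%:E) ->
  ess_sup_itv `]0%R, +oo[ (fun t => (w t)%:E * average H t `^ p^-1) <=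
  (4 `^ p^-1 * C)%:E.
Proof.
move=> ww C0 hC; apply/ess_sup_itvP.
have pV0 : (0 <= p^-1)%R by rewrite invr_ge0 ltW.
(* [unpickle] enumerates the rationals, so that one null set is exceptional for all of them. *)
have : {ae mu, forall t, forall n, if unpickle n is Some q then
    forall t0 : (0 < t)%R,
    (w t)%:E * (cal U (ratr q) t `^ p^-1)%:E <= wU p u w (ratr q) else True}.
  apply/ae_foralln => n; case: unpickle => [q|]; last exact: aeW.
  rewrite /wU; apply: ae_imply (ess_sup_itv_ge _ _) => t ht t0.
  by apply: ht; rewrite in_itv/= t0.
apply: ae_imply => t ht; rewrite in_itv/= andbT => t0.
have [q tq Uq] := primitive_double_rat U_gt0 aU t0.
set x : R := ratr q in tq Uq; have x0 : (0 < x)%R by exact: lt_trans tq.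
have {}ht : (w t)%:E * (cal U x t `^ p^-1)%:E <= wU p u w x.
  by have := ht (pickle q); rewrite pickleK; exact.
have Ux := U_gt0 x0; have Ut := U_gt0 t0; have k0 := cal_gt0 x0 t0.
have Utx : (U t <= U x)%R by apply: primitive_le; rewrite // ltW.
have k2 : (1 <= 2 * cal U x t)%R.
  by rewrite /cal mulrA ler_pdivlMr ?addr_gt0//; lra.
have Hxt : average H t <= 2%:E * average H x.
  rewrite !averageE// muleA -EFinM; apply: lee_pmul.
  - by rewrite lee_fin invr_ge0 ltW.
  - exact: weighted_integral_ge0.
  - rewrite lee_fin -[leLHS]mul1r ler_pdivrMr// mulrAC ler_pdivlMr//.
    by rewrite mul1r.
  - by apply: weighted_integral_le => //; rewrite t0 ltW.
have A0 := average_ge0 H x0; have w0 := ww.2 _ t0.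
apply: (@le_trans _ _ ((4 `^ p^-1)%:E *
    ((w t)%:E * (cal U x t `^ p^-1)%:E * average H x `^ p^-1))); last first.
  rewrite EFinM; apply: lee_wpmul2l; first by rewrite lee_fin powR_ge0.
  apply: le_trans (hC _ x0); apply: lee_wpmul2r => //; exact: poweR_ge0.
rewrite -muleA [leRHS]muleCA; apply: lee_wpmul2l; first by rewrite lee_fin.
have kE : 0 <= (cal U x t)%:E by rewrite lee_fin ltW.
have kA : 0 <= (cal U x t)%:E * average H x by exact: mule_ge0.
rewrite -!poweR_EFin -(poweRM _ kE A0) -poweRM//.
apply: le_poweR => //; first exact: average_ge0.
apply: (le_trans Hxt); rewrite [leRHS]muleA -EFinM.
by apply: lee_wpmul2r => //; rewrite lee_fin; lra.
Qed.

End average.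

(** * Tails of non-negative functions *)

Section tail.
Context {R : realType}.
Local Notation mu := (@lebesgue_measure R).
Local Open Scope ereal_scope.

Definition tail (h : R -> \bar R) s : \bar R := \int[mu]_(z in `]s, +oo[) h z.

Variable h : R -> \bar R.
Hypotheses (mh : measurable_fun (`]0%R, +oo[ : set R) h)
  (h_ge0 : forall t : R, (0 < t)%R -> 0 <= h t).

Lemma tail_ge0 s : (0 < s)%R -> 0 <= tail h s.
Proof.
move=> s0; apply: integral_ge0 => z /=; rewrite in_itv/= andbT => sz.
by apply: h_ge0; exact: lt_trans sz.
Qed.

Lemma tail_nonincreasing s t : (0 < s)%R -> (s <= t)%R -> tail h t <= tail h s.
Proof.
move=> s0 st; apply: ge0_subset_integral => //.
- apply: measurable_funS mh => // x /=; rewrite !in_itv/= !andbT.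
  exact: lt_trans.
- move=> x /=; rewrite in_itv/= andbT => sx; apply: h_ge0.
  exact: lt_trans sx.
- by move=> x /=; rewrite !in_itv/= !andbT; exact: le_lt_trans.
Qed.

End tail.

(** * Dyadic discretisation *)

Section grid.
Context {R : realType}.
Local Notation mu := (@lebesgue_measure R).
Local Open Scope ereal_scope.

Lemma nneseries_le (a : nat -> \bar R) (D : \bar R) : (forall k, 0 <= a k) ->
  (forall N, \sum_(0 <= k < N) a k <= D) -> \sum_(0 <= k <oo) a k <= D.
Proof.
by move=> a0 aD; apply: lime_le; [exact: is_cvg_nneseries|exact: nearW].
Qed.

Lemma le_nneseries_term (a : nat -> \bar R) k : (forall k, 0 <= a k) ->
  a k <= \sum_(0 <= k <oo) a k.
Proof.
move=> a0; apply: le_trans (nneseries_lim_ge k.+1 _) => //.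
by rewrite big_nat_recr//= leeDr// sume_ge0.
Qed.

(** The least n with M / 2^n <= s exists by the Archimedean property and is positive since s < M; k
    is its predecessor. *)
Lemma grid_index (M s : R) : (0 < s)%R -> (s < M)%R ->
  exists k, (M / 2 ^+ k.+1 <= s < M / 2 ^+ k)%R.
Proof.
move=> s0 sM; have ex : exists n, (M / 2 ^+ n <= s)%R.
  exists (Num.bound (M / s)); rewrite ler_pdivrMr ?exprn_gt0//.
  rewrite -ler_pdivrMl// mulrC; apply: ltW.
  apply: (lt_le_trans (archi_boundP _)); first by rewrite divr_ge0 ?ltW// (lt_trans s0).
  by rewrite -natrX ler_nat ltnW// ltn_expl.
case: (ex_minnP ex) => -[|k] hk kmin.
  by move: hk; rewrite expr0 divr1 leNgt sM.
exists k; rewrite hk/= ltNge; apply/negP => /kmin; by rewrite ltnn.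
Qed.

Section average_grid.
Variables (u : R -> R) (p : R).
Local Notation U := (primitive u).
Hypotheses (wu : weight u) (U_gt0 : forall t, (0 < t)%R -> (0 < U t)%R)
  (aU : admissible U) (p_gt0 : (0 < p)%R).
Variable H : R -> \bar R.
Hypotheses (H_ge0 : forall s, (0 < s)%R -> 0 <= H s)
  (H_ni : forall s t, (0 < s)%R -> (s <= t)%R -> H t <= H s).
Variables (x : R) (y : nat -> R).
Hypotheses (x_gt0 : (0 < x)%R)
  (y_grid : forall k, (0 < y k <= x)%R /\ U (y k) = (U x / 2 ^+ k)%R).

(** For s in [y_(k+1), y_k) one has H(s) <= H(y_(k+1)), so [H^p u] lies below the series of the
    [g k], whose k-th integral is U(x) / 2^k times H(y_(k+1))^p. *)
Lemma average_grid_le (D : \bar R) :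
  (forall N, \sum_(0 <= k < N) (2 ^- k)%:E * H (y k.+1) `^ p <= D) ->
  average u p H x <= D.
Proof.
move=> hD.
have y0 k : (0 < y k)%R by have [/andP[]] := y_grid k.
have yx k : (y k <= x)%R by have [/andP[]] := y_grid k.
have Uy k : U (y k) = (U x / 2 ^+ k)%R by have [] := y_grid k.
have Ux := U_gt0 x_gt0.
(* The cut-off keeps all of (0, y_k) instead of [y_(k+1), y_k): the integral of u is then U(y_k)
   itself, and the overlaps are harmless in an upper bound. *)
pose g k := (fun s => H (y k.+1) `^ p * (u s)%:E) \_ `]-oo, (y k)[.
have g0 k s : (0 < s)%R -> 0 <= g k s.
  move=> s0; rewrite /g /patch; case: ifP => // _.
  by rewrite mule_ge0 ?poweR_ge0// lee_fin; exact: wu.2.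
have sub : `]0%R, x[ `<=` (`]0%R, +oo[ : set R).
  by move=> z /=; rewrite !in_itv/= => /andP[->].
have mu' := measurable_funS _ sub (measurable_weight_EFin wu).
have mcu k : measurable_fun (`]0%R, x[ : set R)
    (fun s => H (y k.+1) `^ p * (u s)%:E).
  by apply: emeasurable_funM => //; exact: mu'.
have mg k : measurable_fun (`]0%R, x[ : set R) (g k).
  apply/measurable_restrict => //.
  by apply: measurable_funS (mcu k) => //; exact: subIsetl.
have ig k : \int[mu]_(s in `]0%R, x[) g k s =
    (U x)%:E * ((2 ^- k)%:E * H (y k.+1) `^ p).
  rewrite -integral_mkcondr.
  have -> : `]0%R, x[ `&` `]-oo, (y k)[ = `]0%R, (y k)[%classic.
    apply/seteqP; split => z /=; rewrite !in_itv/=; first by case=> /andP[->].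
    by move=> /andP[-> zy]; rewrite zy (lt_le_trans zy).
  rewrite ge0_integralZl//; last 3 first.
  - have suby : `]0%R, (y k)[ `<=` (`]0%R, +oo[ : set R).
      by move=> z /=; rewrite !in_itv/= => /andP[->].
    exact: (measurable_funS _ suby (measurable_weight_EFin wu)).
  - by move=> z /=; rewrite in_itv/= => /andP[z0 _]; rewrite lee_fin wu.2.
  - exact: poweR_ge0.
  by rewrite primitiveE// Uy EFinM muleC muleA.
rewrite averageE//.
suff wD : weighted_integral u p H x <= (U x)%:E * D.
  apply: (@le_trans _ _ (((U x)^-1)%:E * ((U x)%:E * D))).
    by apply: lee_wpmul2l => //; rewrite lee_fin invr_ge0 ltW.
  by rewrite muleA -EFinM mulVf ?gt_eqF// mul1e.
have gs0 s : (0 < s)%R -> 0 <= \sum_(0 <= k <oo) g k s.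
  by move=> s0; apply: nneseries_ge0 => k _ _; exact: g0.
apply: (@le_trans _ _ (\int[mu]_(s in `]0%R, x[) \sum_(0 <= k <oo) g k s)).
  apply: ge0_le_integral => //.
  - by move=> s /=; rewrite in_itv/= => /andP[s0 _]; exact: weighted_ge0.
  - exact: (measurable_funS _ sub (measurable_weighted p wu H_ni)).
  - apply: (@ge0_emeasurable_sum _ _ _ _ g xpredT) => k; last by [].
    by move=> s /=; rewrite in_itv/= => /andP[s0 _] _; exact: g0.
  move=> s /=; rewrite in_itv/= => /andP[s0 sx].
  have [|k] := @grid_index (U x) (U s) (U_gt0 s0).
    by apply: primitive_lt => //; exact: ltW.
  rewrite -!Uy => /andP[yks syk].
  have {}yks : (y k.+1 <= s)%R.
    rewrite leNgt; apply/negP => /(primitive_lt aU (ltW s0)).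
    by rewrite ltNge yks.
  have {}syk : (s < y k)%R by apply: primitive_lt_inv syk => //; exact: ltW.
  apply: le_trans (@le_nneseries_term (g ^~ s) k _); last first.
    by move=> j; exact: g0.
  rewrite /g /patch mem_set /=; last by rewrite in_itv/=.
  apply: lee_wpmul2r; first by rewrite lee_fin wu.2.
  by apply: le_poweR; rewrite ?(ltW p_gt0) ?H_ge0// H_ni.
rewrite integral_nneseries//; last first.
  by move=> k s /=; rewrite in_itv/= => /andP[s0 _]; exact: g0.
have t0 k : 0 <= (2 ^- k)%:E * H (y k.+1) `^ p.
  by rewrite mule_ge0 ?poweR_ge0// lee_fin invr_ge0 exprn_ge0.
rewrite (eq_eseriesr (fun k _ => ig k)) nneseriesZl//.
by apply: lee_wpmul2l; [rewrite lee_fin ltW|exact: nneseries_le].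
Qed.

End average_grid.

Section tail_sum.
Variables (v : R -> R) (h : R -> \bar R).
Hypotheses (wv : weight v) (mh : measurable_fun (`]0%R, +oo[ : set R) h)
  (h_ge0 : forall t : R, (0 < t)%R -> 0 <= h t).

(** Exchanging sum and integral turns the left-hand side into the integral of [h] against a
    staircase function, which it suffices to compare with [v] almost everywhere. *)
Lemma sum_tail_le (z gam : nat -> R) N (C : R) :
  (forall k, 0 < z k)%R -> (forall k, 0 <= gam k)%R -> (0 <= C)%R ->
  {ae mu, forall s, (0 < s)%R ->
     (\sum_(0 <= k < N) gam k * (z k < s)%R%:R <= C * v s)%R} ->
  \sum_(0 <= k < N) (gam k)%:E * tail h (z k) <=
  C%:E * \int[mu]_(s in `]0%R, +oo[) (h s * (v s)%:E).
Proof.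
move=> z0 gam0 C0 hv.
have mc k : measurable_fun (`]0%R, +oo[ : set R) (fun s => h s * ((z k < s)%R%:R)%:E).
  apply: emeasurable_funM => //; apply/measurable_EFinP.
  rewrite (_ : (fun s => _) = \1_(`](z k), +oo[ : set R)); last first.
    by apply/funext => s; rewrite indicE mem_setE in_itv/= andbT.
  by apply: measurable_funTS.
have tE k : (gam k)%:E * tail h (z k) =
    \int[mu]_(s in `]0%R, +oo[) ((gam k)%:E * (h s * ((z k < s)%R%:R)%:E)).
  rewrite ge0_integralZl//; last 3 first.
  - exact: mc.
  - move=> s /=; rewrite in_itv/= andbT => s0.
    by rewrite mule_ge0 ?h_ge0// lee_fin.
  - by rewrite lee_fin.
  congr (_ * _); rewrite /tail.
  have -> : `](z k), +oo[%classic = `]0%R, +oo[ `&` `](z k), +oo[%classic.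
    apply/seteqP; split => s /=; rewrite !in_itv/= !andbT; last by case.
    by move=> zs; rewrite zs (lt_trans (z0 k)).
  rewrite integral_mkcondr; apply: eq_integral => s _.
  rewrite /patch mem_setE in_itv/= andbT; case: ifP => _.
    by rewrite mule1.
  by rewrite mule0.
under eq_bigr do rewrite tE.
have mvh : measurable_fun (`]0%R, +oo[ : set R) (fun s => h s * (v s)%:E).
  by apply: emeasurable_funM => //; exact: measurable_weight_EFin.
have hc0 k s : (0 < s)%R -> 0 <= h s * ((z k < s)%R%:R)%:E.
  by move=> s0; rewrite mule_ge0 ?h_ge0// lee_fin.
have hv0 s : (0 < s)%R -> 0 <= h s * (v s)%:E.
  by move=> s0; rewrite mule_ge0 ?h_ge0// lee_fin wv.2.
rewrite -ge0_integral_sum//; last 2 first.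
- by move=> k; apply: emeasurable_funM => //; exact: mc.
- move=> k s /=; rewrite in_itv/= andbT => s0.
  by rewrite mule_ge0 ?lee_fin// hc0.
rewrite -ge0_integralZl//; last first.
  by move=> s /=; rewrite in_itv/= andbT; exact: hv0.
apply: ae_ge0_le_integral => //.
- move=> s /=; rewrite in_itv/= andbT => s0; apply: sume_ge0 => k _.
  by rewrite mule_ge0 ?lee_fin// hc0.
- by apply: emeasurable_sum => k; apply: emeasurable_funM => //; exact: mc.
- move=> s /=; rewrite in_itv/= andbT => s0.
  by rewrite mule_ge0 ?lee_fin// hv0.
- by apply: emeasurable_funM => //; exact: mvh.
apply: ae_imply hv => s hs /=; rewrite in_itv/= andbT => s0.
under eq_bigr do rewrite muleCA -EFinM.
rewrite -ge0_sume_distrr; last by move=> k _; rewrite lee_fin mulr_ge0.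
rewrite muleCA sumEFin -EFinM; apply: lee_wpmul2l; first exact: h_ge0.
by rewrite lee_fin hs.
Qed.

(** At a point s let m be the least index below N with z_m < s. The earlier steps vanish at s, the
    remaining ones add up to at most C / b_m, and v(s) >= 1 / b_m. If there is no such m, the
    staircase is 0 at s. *)
Lemma sum_tail_staircase_le (z gam b : nat -> R) N (C : R) :
  (forall k, 0 < z k)%R -> (forall k, 0 <= gam k)%R -> (0 <= C)%R ->
  (forall k, {ae mu, forall s, (z k < s)%R -> ((b k)^-1 <= v s)%R}) ->
  (forall m, (m < N)%N -> (\sum_(m <= k < N) gam k <= C / b m)%R) ->
  \sum_(0 <= k < N) (gam k)%:E * tail h (z k) <=
  C%:E * \int[mu]_(s in `]0%R, +oo[) (h s * (v s)%:E).
Proof.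
move=> z0 gam0 C0 /ae_foralln hb hC; apply: sum_tail_le => //.
apply: ae_imply hb => s hs s0.
have [[k0 /andP[k0N zk0]]|nex] := pselect (exists k, (k < N)%N && (z k < s)%R).
  have ex : exists k, (k < N)%N && (z k < s)%R by exists k0; rewrite k0N.
  case: (ex_minnP ex) => m /andP[mN zm] mmin.
  apply: (@le_trans _ _ (C / b m)%R); last by rewrite ler_wpM2l// hs.
  apply: le_trans (hC _ mN); rewrite (@big_cat_nat _ _ _ m)//=; last exact: ltnW.
  rewrite big_nat big1 ?add0r => [|k /andP[_ km]].
    by apply: ler_sum => k _; rewrite ler_piMr// lern1; case: ltP.
  have [zk|] := ltP (z k) s; last by rewrite mulr0.
  by move: (mmin k); rewrite zk (ltn_trans km mN) => /(_ isT); rewrite leqNgt km.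
rewrite big_nat big1 ?mulr_ge0 ?wv.2// => k /andP[_ kN].
have [zk|] := ltP (z k) s; last by rewrite mulr0.
by exfalso; apply: nex; exists k; rewrite kN.
Qed.

End tail_sum.
End grid.

(** * Elementary inequalities for powers, geometric sums and running maxima *)

Section sequences.
Context {R : realType}.
Implicit Types (p q a b : R).

Lemma powR_exprn a q n : 0 <= a -> (a ^+ n) `^ q = (a `^ q) ^+ n.
Proof.
by move=> a0; rewrite -powR_mulrn// powRAC powR_mulrn// powR_ge0.
Qed.

(** A crude form of Young's inequality: bound both bases by a + b and add the exponents. The latter
    requires a + b to be nonzero. *)
Lemma powR_mul_le_add a b p : 0 <= a -> 0 <= b -> 0 < p -> p < 1 ->
  a `^ p * b `^ (1 - p) <= a + b.
Proof.
move=> a0 b0 p0 p1; have ab0 : 0 <= a + b by exact: addr_ge0.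
have [ab|abn] := eqVneq (a + b) 0.
  have -> : a = 0 by lra.
  by rewrite powR0 ?gt_eqF// mul0r add0r.
rewrite -[leRHS]powRr1// [in leRHS](_ : 1 = p + (1 - p)); last by ring.
rewrite powRD; last by rewrite abn implybT.
by apply: ler_pM; rewrite ?powR_ge0// ge0_ler_powR ?nnegrE//; lra.
Qed.

Lemma geometric_sum_le (rho : R) m N : 0 < rho < 1 ->
  \sum_(m <= k < N) rho ^+ k <= rho ^+ m / (1 - rho).
Proof.
move=> /andP[r0 r1]; have r1' : 0 < 1 - rho by rewrite subr_gt0.
have [Nm|mN] := leqP N m.
  by rewrite big_geq// divr_ge0 ?exprn_ge0 ?ltW.
suff E : \sum_(m <= k < N) rho ^+ k = (rho ^+ m - rho ^+ N) / (1 - rho).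
  by rewrite E ler_pM2r ?invr_gt0// gerBl exprn_ge0 ?ltW.
rewrite -(subnKC (ltnW mN)); elim: (N - m)%N => [|n ih].
  by rewrite addn0 big_geq// subrr mul0r.
rewrite addnS big_nat_recr ?leq_addr//= ih exprS.
by field; rewrite gt_eqF.
Qed.

(** Every term is at most T, hence its p-th power is at most T^(p-1) times the term itself, as p >=
    1. *)
Lemma sum_poweR_le (a : nat -> \bar R) p (T : R) N :
  1 <= p -> 0 < T -> (forall k, 0 <= a k)%E ->
  (\sum_(0 <= k < N) a k <= T%:E)%E ->
  (\sum_(0 <= k < N) a k `^ p <= (T `^ p)%:E)%E.
Proof.
move=> p1 T0 a0 aT; have p0 : 0 < p by exact: lt_le_trans p1.
have aTk k : (k < N)%N -> (a k <= T%:E)%E.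
  move=> kN; apply: le_trans aT; rewrite big_mkord (bigD1 (Ordinal kN))//=.
  by rewrite leeDl// sume_ge0.
apply: (@le_trans _ _ ((T `^ p / T)%:E * \sum_(0 <= k < N) a k)%E); last first.
  apply: (@le_trans _ _ ((T `^ p / T)%:E * T%:E)%E).
    by apply: lee_wpmul2l => //; rewrite lee_fin divr_ge0 ?powR_ge0 ?ltW.
  by rewrite -EFinM mulfVK ?gt_eqF.
rewrite ge0_sume_distrr//; rewrite big_nat [leRHS]big_nat.
apply: lee_sum => k /andP[_ kN].
have := aTk _ kN; have := a0 k; case: (a k) => [r| |]; rewrite ?leeNy_eq//=.
rewrite !lee_fin => r0 rT.
move: r0; rewrite le_eqVlt => /predU1P[<-|r0].
  by rewrite powR0 ?gt_eqF// mulr0.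
rewrite -{1}(divfK (lt0r_neq0 T0) r).
rewrite powRM ?divr_ge0 ?(ltW T0) ?(ltW r0)//.
rewrite mulrC -mulrA ler_pM2l ?powR_gt0// [leRHS]mulrC.
apply: ge1r_powR => //; rewrite divr_gt0//= ler_pdivrMr// mul1r//.
Qed.

Section running_max.
Variables (b : nat -> R).
Hypothesis b_gt0 : forall k, 0 < b k.

(** The weights theta_k: the least non-decreasing majorant of b_k / 2^k. Monotonicity makes sums of
    2^-k / theta_k geometric, while the powers of theta_k still sum like those of b_k / 2^k. *)
Fixpoint running_max k : R :=
  if k is j.+1 then Num.max (running_max j) (b k / 2 ^+ k) else b 0.

Lemma running_max_ge k : b k / 2 ^+ k <= running_max k.
Proof. by case: k => [|k] /=; rewrite ?expr0 ?divr1// le_max lexx orbT. Qed.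

Lemma running_max_gt0 k : 0 < running_max k.
Proof.
by apply: lt_le_trans (running_max_ge k); rewrite divr_gt0 ?exprn_gt0.
Qed.

Lemma running_max_homo : {homo running_max : m n / (m <= n)%N >-> m <= n}.
Proof.
apply: homo_leq => [//|x y z|n]; first exact: le_trans.
by rewrite /= le_max lexx.
Qed.

(** For k >= m one has theta_k >= theta_m >= b_m / 2^m, and the 2^-k from m on sum to at most 2 /
    2^m. This is the staircase hypothesis with C = 2. *)
Lemma sum_running_maxV_le m N :
  \sum_(m <= k < N) 2 ^- k / running_max k <= 2 / b m.
Proof.
apply: (@le_trans _ _ (\sum_(m <= k < N) (2^-1) ^+ k / running_max m)).
  rewrite big_nat [leRHS]big_nat; apply: ler_sum => k /andP[mk _].
  rewrite exprVn ler_pM2l ?invr_gt0 ?exprn_gt0//.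
  by rewrite lef_pV2 ?posrE ?running_max_gt0// running_max_homo.
rewrite -mulr_suml.
apply: (@le_trans _ _ ((2^-1) ^+ m / (1 - 2^-1) / running_max m)).
  rewrite ler_pM2r ?invr_gt0 ?running_max_gt0//.
  by apply: geometric_sum_le; lra.
rewrite (_ : 1 - 2^-1 = 2^-1 :> R); last by lra.
rewrite invrK mulrAC mulrC ler_pM2l//.
rewrite ler_pdivrMr ?running_max_gt0// mulrC ler_pdivlMr//.
by rewrite exprVn mulrC running_max_ge.
Qed.

(** Bounding the q-th power of a maximum by the sum of the q-th powers gives a recursion for [a k]
    with ratio 1/2, so the sum at most doubles. *)
Lemma sum_running_max_powR_le q (S : R) N : 0 < q ->
  (forall n, \sum_(0 <= k < n) (2 ^- k) `^ (1 + q) * b k `^ q <= S) ->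
  \sum_(0 <= k < N) 2 ^- k * running_max k `^ q <= 2 * S.
Proof.
move=> q0 hS.
have S0 : 0 <= S by have := hS 0%N; rewrite big_geq.
have bE k : 2 ^- k * (b k / 2 ^+ k) `^ q = (2 ^- k) `^ (1 + q) * b k `^ q.
  rewrite powRM ?(ltW (b_gt0 k)) ?invr_ge0 ?exprn_ge0//.
  rewrite powRD ?powRr1 ?invr_ge0 ?exprn_ge0//; first by ring.
  by rewrite invr_eq0 expf_eq0 pnatr_eq0 andbF implybT.
case: N => [|N]; first by rewrite big_geq// mulr_ge0.
pose a k := 2 ^- k * running_max k `^ q.
have a0 k : 0 <= a k by rewrite mulr_ge0 ?powR_ge0 ?invr_ge0 ?exprn_ge0.
have aS k : a k.+1 <= 2^-1 * a k + (2 ^- k.+1) `^ (1 + q) * b k.+1 `^ q.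
  rewrite -bE /a (_ : 2^-1 * _ = 2 ^- k.+1 * running_max k `^ q); last first.
    by rewrite exprS invfM mulrA.
  rewrite -mulrDr ler_pM2l ?invr_gt0 ?exprn_gt0//=.
  by rewrite maxEle; case: ifP; rewrite ?lerDr ?lerDl powR_ge0.
(* The extra term [a N] makes the induction close: the next step adds twice a_(n+1), which [aS]
   bounds by a_n plus twice the new summand. *)
suff : \sum_(0 <= k < N.+1) a k + a N <=
    2 * \sum_(0 <= k < N.+1) (2 ^- k) `^ (1 + q) * b k `^ q.
  by have := hS N.+1; have := a0 N; lra.
elim: N => [|n ih].
  rewrite !big_nat1 -bE /a expr0 invr1 !mul1r mulr1 /=; lra.
rewrite big_nat_recr//= [in leRHS]big_nat_recr//=.
by have := aS n; lra.
Qed.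

End running_max.

End sequences.

(** * Sufficiency at a fixed point *)

Section sufficiency.
Context {R : realType} (u v : R -> R) (p : R).
Local Notation mu := (@lebesgue_measure R).
Local Notation U := (primitive u).
Hypotheses (wu : weight u) (wv : weight v)
  (U_gt0 : forall t, 0 < t -> 0 < U t) (aU : admissible U) (p_gt0 : 0 < p).
Local Open Scope ereal_scope.

(** Fixes x. The integral of [h v] is replaced by a positive real upper bound J, so that the
    estimates at x can normalise by J. *)
Lemma inequality_of_average (w : R -> R) (C : R) : weight w -> (0 < C)%R ->
  (forall (h : R -> \bar R) (J x : R),
    measurable_fun (`]0%R, +oo[ : set R) h ->
    (forall t : R, (0 < t)%R -> 0 <= h t) -> (0 < J)%R ->
    \int[mu]_(z in `]0%R, +oo[) (h z * (v z)%:E) <= J%:E -> (0 < x)%R ->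
    wU p u w x * average u p (tail h) x `^ p^-1 <= (C * J)%:E) ->
  inequality p u v w (4 `^ p^-1 * C).
Proof.
move=> ww C0 hC h mh h0; set I := \int[mu]_(z in _) _.
have I0 : 0 <= I.
  apply: integral_ge0 => z /=; rewrite in_itv/= andbT => z0.
  by rewrite mule_ge0 ?h0// lee_fin wv.2.
have D0 : (0 < 4 `^ p^-1 * C)%R by rewrite mulr_gt0// powR_gt0.
have [->|Iy] := eqVneq I +oo; first by rewrite gt0_muley ?lte_fin// leey.
have If : I \is a fin_num by rewrite ge0_fin_numE// ltey.
apply/lee_addgt0Pr => e e0.
(* The excess over the integral is chosen to cost exactly [e] after multiplication by the final
   constant. *)
pose J := (fine I + e / (4 `^ p^-1 * C))%R.
have J0 : (0 < J)%R by rewrite ltr_wpDl ?divr_gt0// fine_ge0.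
have -> : (4 `^ p^-1 * C)%:E * I + e%:E = (4 `^ p^-1 * (C * J))%:E.
  rewrite -(fineK If) -EFinM -EFinD; congr EFin.
  by rewrite /J mulrA mulrDr mulrCA divff ?mulr1// gt_eqF.
apply: (average_wU_le wu U_gt0 aU p_gt0 _ _ ww _).
- by move=> s s0; exact: tail_ge0.
- by move=> s t s0 st; exact: tail_nonincreasing.
- by rewrite mulr_ge0// ltW.
move=> x x0; apply: hC => //; rewrite -/I -(fineK If) lee_fin lerDl.
by rewrite ltW// divr_gt0.
Qed.

Section fixed_point.
Variables (x J : R) (y : nat -> R) (h : R -> \bar R).
Hypotheses (x_gt0 : (0 < x)%R)
  (y_grid : forall k, (0 < y k <= x)%R /\ U (y k) = (U x / 2 ^+ k)%R)
  (mh : measurable_fun (`]0%R, +oo[ : set R) h)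
  (h_ge0 : forall t : R, (0 < t)%R -> 0 <= h t) (J_gt0 : (0 < J)%R)
  (hJ : \int[mu]_(z in `]0%R, +oo[) (h z * (v z)%:E) <= J%:E)
  (vbar_fin : forall k, vbar v `](y k.+1), +oo[ < +oo).

Let b k := fine (vbar v `](y k.+1), +oo[).

Let y0 k : (0 < y k)%R. Proof. by have [/andP[]] := y_grid k. Qed.

Let b0 k : (0 < b k)%R.
Proof. by rewrite fine_gt0// vbar_fin andbT vbar_gt0// ltW. Qed.

Let bv k : {ae mu, forall s, (y k.+1 < s)%R -> ((b k)^-1 <= v s)%R}.
Proof. by apply: vbar_ae; rewrite // ltW. Qed.

Let tail0 k : 0 <= tail h (y k). Proof. exact: tail_ge0. Qed.

(** With rho = 2^(-1/p) the terms of the grid sum are the p-th powers of rho^k H(y_(k+1)), so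
    [sum_poweR_le] reduces to their plain sum. Its staircase from m on is at most rho^m / (1 - rho),
    and rho^m <= D / b_m. *)
Lemma average_tail_ge1 (D : R) : (1 <= p)%R -> (0 < D)%R ->
  (forall k, (((2^-1) `^ p^-1) ^+ k * b k <= D)%R) ->
  average u p (tail h) x `^ p^-1 <= (D / (1 - (2^-1) `^ p^-1) * J)%:E.
Proof.
move=> p1 D0 hD; set rho := ((2^-1) `^ p^-1)%R in hD *.
have rho0 : (0 < rho)%R by rewrite powR_gt0// invr_gt0.
have rho1 : (rho < 1)%R.
  have <- : (1 `^ p^-1 = 1 :> R)%R by rewrite powR1.
  by apply: gt0_ltr_powR; rewrite ?invr_gt0 ?nnegrE//; lra.
have r10 : (0 < 1 - rho)%R by rewrite subr_gt0.
set T := (D / (1 - rho) * J)%R; have T0 : (0 < T)%R by rewrite mulr_gt0// divr_gt0.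
have hT N : \sum_(0 <= k < N) (rho ^+ k)%:E * tail h (y k.+1) <= T%:E.
  rewrite [T%:E]EFinM; apply: (@le_trans _ _ ((D / (1 - rho))%:E *
      \int[mu]_(z in `]0%R, +oo[) (h z * (v z)%:E))); last first.
    by apply: lee_wpmul2l => //; rewrite lee_fin divr_ge0 ?ltW.
  apply: (@sum_tail_staircase_le _ v h wv mh h_ge0 (fun k => y k.+1) _ b) => //.
  - by move=> k; rewrite exprn_ge0 ?ltW.
  - by rewrite divr_ge0 ?ltW.
  move=> m _; apply: le_trans (geometric_sum_le _ _ _) _; first by rewrite rho0.
  rewrite mulrAC ler_pM2r ?invr_gt0// ler_pdivlMr//.
have hS N : \sum_(0 <= k < N) (2 ^- k)%:E * tail h (y k.+1) `^ p <=
    (T `^ p)%:E.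
  under eq_bigr => k _.
    have -> : (2 ^- k)%:E * tail h (y k.+1) `^ p =
        ((rho ^+ k)%:E * tail h (y k.+1)) `^ p.
      rewrite poweRM ?tail0 ?lee_fin ?exprn_ge0 ?(ltW rho0)// poweR_EFin.
      rewrite powR_exprn ?(ltW rho0)// /rho -powRrM mulVf ?gt_eqF//.
      by rewrite powRr1 ?invr_ge0// exprVn.
    over.
  apply: sum_poweR_le => // k.
  by rewrite mule_ge0 ?lee_fin ?exprn_ge0 ?(ltW rho0).
have : average u p (tail h) x <= (T `^ p)%:E.
  apply: (average_grid_le wu U_gt0 aU p_gt0 _ _ x_gt0 y_grid hS).
  - by move=> s s0; exact: tail_ge0.
  - by move=> s t s0 st; exact: tail_nonincreasing.
move=> /le_poweR; move=> /(_ p^-1%R) => hle.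
apply: le_trans (hle _ _) _; rewrite ?invr_ge0 ?(ltW p_gt0)//.
  by apply: average_ge0.
by rewrite poweR_EFin -powRrM mulfV ?gt_eqF// powRr1// ltW.
Qed.

(* Hoelder's inequality with the weights [running_max b], followed by the
   staircase estimate. *)
Lemma average_tail_lt1 (S : R) : (p < 1)%R -> (0 < S)%R ->
  (forall N, \sum_(0 <= k < N)
     (2 ^- k) `^ (pstar p / p) * b k `^ pstar p <= S)%R ->
  average u p (tail h) x `^ p^-1 <= (4 `^ p^-1 * J * S `^ (pstar p)^-1)%:E.
Proof.
move=> p1 S0 hS; set q := pstar p in hS *.
have p1' : (0 < 1 - p)%R by rewrite subr_gt0.
have q0 : (0 < q)%R by rewrite divr_gt0.
have qp : (q / p = 1 + q)%R by rewrite /q /pstar; field; rewrite !gt_eqF.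
rewrite qp in hS.
pose th := running_max b; have th0 k : (0 < th k)%R by exact: running_max_gt0.
have h1 N : \sum_(0 <= k < N) (2 ^- k / th k)%:E * tail h (y k.+1) <= (2 * J)%:E.
  rewrite EFinM; apply: (@le_trans _ _ (2%:E *
      \int[mu]_(z in `]0%R, +oo[) (h z * (v z)%:E))); last first.
    by apply: lee_wpmul2l => //; rewrite lee_fin.
  apply: (@sum_tail_staircase_le _ v h wv mh h_ge0 (fun k => y k.+1) _ b) => //.
  - by move=> k; rewrite divr_ge0 ?invr_ge0 ?exprn_ge0 ?ltW.
  - by move=> m _; exact: sum_running_maxV_le.
have h2 N : (\sum_(0 <= k < N) 2 ^- k * th k `^ q <= 2 * S)%R.
  exact: sum_running_max_powR_le.
have JS0 : (0 < J `^ p * S `^ (1 - p))%R by rewrite mulr_gt0 ?powR_gt0.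
(* Since q (1 - p) = p, H^p is J^p S^(1-p) times the product of (H / (theta_k J))^p and (theta_k^q /
   S)^(1-p). Normalising by J and S makes both resulting sums at most 2, by [h1] and [h2]; hence the
   4 in [hN]. *)
have term k : tail h (y k.+1) `^ p <= (J `^ p * S `^ (1 - p))%:E *
    ((th k * J)^-1%:E * tail h (y k.+1) + (th k `^ q / S)%:E).
  have tJ : (0 < th k * J)%R by rewrite mulr_gt0.
  have := tail0 k.+1; case: (tail _ _) => [r| |] //; last first.
    move=> _; rewrite gt0_muley ?lte_fin ?invr_gt0//= addye//.
    by rewrite gt0_muley ?lte_fin// leey.
  rewrite lee_fin poweR_EFin => r0.
  change ((r `^ p)%:E <= (J `^ p * S `^ (1 - p) *
    ((th k * J)^-1 * r + th k `^ q / S))%:E).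
  rewrite lee_fin.
  have -> : (r `^ p = J `^ p * S `^ (1 - p) *
      (((th k * J)^-1 * r) `^ p * (th k `^ q / S) `^ (1 - p)))%R.
    rewrite !powRM ?invr_ge0 ?powR_ge0 ?(ltW tJ) ?(ltW S0)//.
    rewrite -!powR_inv1 ?(ltW tJ) ?(ltW S0)// -!powRrM !mulN1r.
    rewrite powRM ?(ltW J_gt0) ?(ltW (th0 k))//.
    have -> : (q * (1 - p) = p)%R by rewrite /q /pstar; field; rewrite !gt_eqF.
    rewrite !powRN; field.
    by rewrite !gt_eqF// ?powR_gt0.
  rewrite ler_pM2l//; apply: powR_mul_le_add => //.
    by rewrite mulr_ge0// invr_ge0 ltW.
  by rewrite divr_ge0 ?powR_ge0// ltW.
have hN N : \sum_(0 <= k < N) (2 ^- k)%:E * tail h (y k.+1) `^ p <=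
    (4 * (J `^ p * S `^ (1 - p)))%:E.
  apply: (@le_trans _ _ (\sum_(0 <= k < N) ((J `^ p * S `^ (1 - p))%:E *
      ((J^-1)%:E * ((2 ^- k / th k)%:E * tail h (y k.+1)) +
       (S^-1)%:E * (2 ^- k * th k `^ q)%:E)))).
    apply: lee_sum => k _; have k0 : 0 <= (2 ^- k)%:E :> \bar R.
      by rewrite lee_fin invr_ge0 exprn_ge0.
    apply: (le_trans (lee_wpmul2l k0 (term k))).
    rewrite muleCA; apply: lee_wpmul2l; first by rewrite lee_fin ltW.
    rewrite ge0_muleDr; last 2 first.
    - by rewrite mule_ge0// lee_fin invr_ge0 ltW// mulr_gt0.
    - by rewrite lee_fin divr_ge0 ?powR_ge0 ?ltW.
    rewrite !muleA -!EFinM; apply: leeD.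
      by rewrite (_ : J^-1 * _ = 2 ^- k * (th k * J)^-1)%R// invfM; ring.
    by rewrite lee_fin mulrA [leRHS]mulrC.
  rewrite -ge0_sume_distrr; last first.
    move=> k _; rewrite adde_ge0// mule_ge0 ?lee_fin ?invr_ge0 ?(ltW J_gt0) ?(ltW S0)//.
      by rewrite mule_ge0// lee_fin divr_ge0 ?invr_ge0 ?exprn_ge0 ?ltW.
    by rewrite mulr_ge0 ?powR_ge0 ?invr_ge0 ?exprn_ge0.
  rewrite [leRHS]EFinM muleC; apply: lee_wpmul2r; first by rewrite lee_fin ltW.
  rewrite big_split/=.
  rewrite (_ : 4%:E = 2%:E + 2%:E :> \bar R); last by rewrite -EFinD; congr EFin; lra.
  apply: leeD.
    rewrite -ge0_sume_distrr; last first.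
      by move=> k _; rewrite mule_ge0// lee_fin divr_ge0 ?invr_ge0 ?exprn_ge0 ?ltW.
    apply: (@le_trans _ _ ((J^-1)%:E * (2 * J)%:E)).
      by apply: lee_wpmul2l => //; rewrite lee_fin invr_ge0 ltW.
    by rewrite -EFinM mulrC mulfK ?gt_eqF.
  rewrite -ge0_sume_distrr; last first.
    by move=> k _; rewrite lee_fin mulr_ge0 ?powR_ge0 ?invr_ge0 ?exprn_ge0.
  rewrite sumEFin -EFinM lee_fin mulrC ler_pdivrMr//; exact: h2.
have : average u p (tail h) x <= (4 * (J `^ p * S `^ (1 - p)))%:E.
  apply: (average_grid_le wu U_gt0 aU p_gt0 _ _ x_gt0 y_grid hN).
  - by move=> s s0; exact: tail_ge0.
  - by move=> s t s0 st; exact: tail_nonincreasing.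
move=> /le_poweR; move=> /(_ p^-1%R) => hle.
apply: le_trans (hle _ _) _; rewrite ?invr_ge0 ?(ltW p_gt0)//.
  by apply: average_ge0.
rewrite poweR_EFin !powRM ?mulr_ge0 ?powR_ge0// -!powRrM mulfV ?gt_eqF//.
rewrite powRr1 ?(ltW J_gt0)// mulrA /q /pstar invf_div//.
Qed.

End fixed_point.
End sufficiency.

(** * Test functions and necessity *)

Section test_functions.
Context {R : realType} (v : R -> R).
Local Notation mu := (@lebesgue_measure R).
Hypothesis wv : weight v.
Local Open Scope ereal_scope.

(** If v < beta held only on a null subset of (a, oo), [vbar] would be at most 1 / beta. Truncation
    to (a, n) makes the measure finite, and some truncation is not null by countable
    subadditivity. *)
Lemma vbar_gt_set (a beta : R) : (0 < a)%R -> (0 < beta)%R ->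
  (beta^-1)%:E < vbar v `]a, +oo[ ->
  exists E : set R, [/\ measurable E, E `<=` `]a, +oo[,
    forall s, E s -> (v s <= beta)%R & 0 < mu E < +oo].
Proof.
move=> a0 b0 hb.
pose E0 := `]a, +oo[ `&` v @^-1` `]-oo, beta[.
have mv : measurable_fun (`]a, +oo[ : set R) v.
  apply: measurable_funS (weight_measurable wv) => // s /=.
  by rewrite !in_itv/= !andbT; exact: lt_trans.
have mE0 : measurable E0 by apply: mv.
pose E n := E0 `&` `]a, n%:R[.
have mE n : measurable (E n) by apply: measurableI.
suff [n En] : exists n, 0 < mu (E n).
  exists (E n); split => //.
  - by move=> s [[]].
  - by move=> s [[_ /=]]; rewrite in_itv/= => /ltW.
  rewrite En/=; apply: (@le_lt_trans _ _ (mu `]a, n%:R[)).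
    by apply: le_measure; rewrite ?inE; [exact: mE|by []|exact: subIsetr].
  rewrite lebesgue_measure_itv/=; case: ifP => _; last by rewrite ltry.
  by rewrite -EFinB ltry.
apply: contrapT => nE.
have E00 : mu.-negligible E0.
  have -> : E0 = \bigcup_n E n.
    apply/seteqP; split => s; last by move=> [n _ []].
    move=> E0s; exists (Num.bound s) => //; split => //=.
    rewrite in_itv/=; case: E0s => /= + _; rewrite in_itv/= andbT => sa.
    by rewrite sa archi_boundP// ltW// (lt_trans a0).
  apply: negligible_bigcup => n; exists (E n); split => //; first exact: mE.
  apply/eqP; rewrite eq_le measure_ge0 andbT leNgt; apply/negP => En.
  by apply: nE; exists n.
move: hb; rewrite ltNge => /negP; apply; apply/ess_sup_itvP.
apply: negligibleS E00 => s /= h; apply: contrapT => nE0s; apply: h.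
move=> sa; have {nE0s} : (beta <= v s)%R.
  rewrite leNgt; apply/negP => vs; apply: nE0s; split => //=.
move=> bv; have v0 : (0 < v s)%R by exact: lt_le_trans bv.
by rewrite inver gt_eqF// lee_fin lef_pV2.
Qed.

(** The normalised indicator of the set from [vbar_gt_set]: unit mass beyond a, placed where v <=
    beta. *)
Lemma unit_tail_exists (a beta : R) : (0 < a)%R -> (0 < beta)%R ->
  (beta^-1)%:E < vbar v `]a, +oo[ ->
  exists h : R -> \bar R, [/\ measurable_fun (`]0%R, +oo[ : set R) h,
    forall s, 0 <= h s,
    forall s, (0 < s <= a)%R -> 1 <= tail h s &
    \int[mu]_(z in `]0%R, +oo[) (h z * (v z)%:E) <= beta%:E].
Proof.
move=> a0 b0 /vbar_gt_set[]// E [mE Ea vE /andP[E0 Ey]].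
have Ef : mu E \is a fin_num by rewrite ge0_fin_numE.
pose m := fine (mu E); have m0 : (0 < m)%R by rewrite fine_gt0// E0.
pose h s : \bar R := (m^-1)%:E * (\1_E s)%:E.
have h0 s : 0 <= h s by rewrite mule_ge0// lee_fin// invr_ge0 ltW.
have mh (D : set R) : measurable D -> measurable_fun D h.
  move=> mD; apply: emeasurable_funM => //; apply/measurable_EFinP.
  exact: measurable_funTS.
have ih (s : R) : (s <= a)%R -> \int[mu]_(z in `]s, +oo[) h z = 1.
  move=> sa; rewrite ge0_integralZl//; last 2 first.
  - apply/(@measurable_EFinP _ _ _ _ \1_E); exact: measurable_funTS.
  - by rewrite lee_fin invr_ge0 ltW.
  rewrite integral_indic// setIidl.
    rewrite [X in _ * X](_ : _ = m%:E) -?EFinM ?mulVf ?gt_eqF//.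
    by rewrite /m fineK.
  by move=> z /Ea /=; rewrite !in_itv/= !andbT; exact: le_lt_trans.
exists h; split => //.
- exact: mh.
- by move=> s /andP[s0 sa]; rewrite /tail ih.
rewrite -[leRHS]mule1 -(ih 0%R (ltW a0)) -ge0_integralZl//; last 2 first.
- exact: mh.
- by rewrite lee_fin ltW.
have mv := measurable_weight_EFin wv.
apply: ge0_le_integral => //.
- move=> z /=; rewrite in_itv/= andbT => z0.
  by rewrite mule_ge0// lee_fin wv.2.
- by apply: emeasurable_funM => //; exact: mh.
- by apply: emeasurable_funM => //; exact: mh.
move=> z _; rewrite muleC /h indicE.
have [zE|_] := boolP (z \in E); last by rewrite !mule0.
apply: lee_wpmul2r; first by rewrite mule1 lee_fin invr_ge0 ltW.
by rewrite lee_fin vE// -in_setE.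
Qed.

(** Superpose m_k times the unit test functions. Costs add up, while a lower bound for the tail
    survives the addition of further non-negative terms. *)
Lemma tail_minorant_exists (a m beta : nat -> R) N : (forall k, 0 < a k)%R ->
  (forall k, 0 <= m k)%R -> (forall k, 0 < beta k)%R ->
  (forall k, ((beta k)^-1)%:E < vbar v `](a k), +oo[) ->
  exists h : R -> \bar R, [/\ measurable_fun (`]0%R, +oo[ : set R) h,
    forall s, 0 <= h s,
    forall k s, (k < N)%N -> (0 < s <= a k)%R -> (m k)%:E <= tail h s &
    \int[mu]_(z in `]0%R, +oo[) (h z * (v z)%:E) <=
    (\sum_(0 <= k < N) m k * beta k)%:E].
Proof.
move=> a0 m0 b0 hb; elim: N => [|N [g [mg g0 gt gv]]].
  exists (cst 0); split => //.
  rewrite big_geq// integral0_eq// => z _; by rewrite mul0e.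
have [h [mh h0 ht hv]] := unit_tail_exists (a0 N) (b0 N) (hb N).
have sub s : (0 < s)%R -> `]s, +oo[ `<=` (`]0%R, +oo[ : set R).
  by move=> s0 z /=; rewrite !in_itv/= !andbT; exact: lt_trans.
have mhm : measurable_fun (`]0%R, +oo[ : set R) (fun z => (m N)%:E * h z).
  by apply: emeasurable_funM.
have hm0 z : 0 <= (m N)%:E * h z by rewrite mule_ge0// lee_fin.
have tE s : (0 < s)%R ->
    tail (fun z => g z + (m N)%:E * h z) s = tail g s + (m N)%:E * tail h s.
  move=> s0; rewrite /tail ge0_integralD//.
  - rewrite ge0_integralZl//; last by rewrite lee_fin.
    exact: (measurable_funS _ (sub _ s0) mh).
  - exact: (measurable_funS _ (sub _ s0) mg).
  - exact: (measurable_funS _ (sub _ s0) mhm).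
have mv := measurable_weight_EFin wv.
exists (fun z => g z + (m N)%:E * h z); split.
- exact: emeasurable_funD.
- by move=> s; rewrite adde_ge0.
- move=> k s; rewrite ltnS leq_eqVlt => /predU1P[->|kN] sk;
    have /andP[s0 _] := sk; rewrite tE//.
    apply: (@le_trans _ _ ((m N)%:E * tail h s)).
      by rewrite -[leLHS]mule1; apply: lee_wpmul2l; rewrite ?lee_fin// ht.
    by rewrite leeDr// integral_ge0.
  apply: (le_trans (gt _ _ kN sk)).
  by rewrite leeDl// mule_ge0 ?lee_fin// integral_ge0.
rewrite big_nat_recr//= EFinD.
rewrite (@eq_integral _ _ _ mu _ (fun z => g z * (v z)%:E +
    (m N)%:E * (h z * (v z)%:E))); last first.
  by move=> z _; rewrite ge0_muleDl// muleA.
have v0 (z : R) : `]0%R, +oo[%classic z -> 0 <= (v z)%:E.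
  by rewrite /= in_itv/= andbT lee_fin; exact: wv.2.
have mhv : measurable_fun (`]0%R, +oo[ : set R) (fun z => h z * (v z)%:E).
  exact: emeasurable_funM.
rewrite ge0_integralD//.
- rewrite leeD// ge0_integralZl//.
  + by rewrite EFinM; apply: lee_wpmul2l => //; rewrite lee_fin.
  + by move=> z /v0 ?; rewrite mule_ge0.
  + by rewrite lee_fin.
- by move=> z /v0 ?; rewrite mule_ge0.
- exact: emeasurable_funM.
- by move=> z /v0 ?; rewrite mule_ge0 ?lee_fin// mule_ge0.
- exact: emeasurable_funM.
Qed.

End test_functions.

Section necessity.
Context {R : realType} (u v w : R -> R) (p c : R).
Local Notation mu := (@lebesgue_measure R).
Local Notation U := (primitive u).
Hypotheses (wu : weight u) (wv : weight v) (ww : weight w)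
  (U_gt0 : forall t, 0 < t -> 0 < U t) (aU : admissible U) (p_gt0 : 0 < p)
  (c_ge0 : 0 <= c) (ineq : inequality p u v w c).
Local Open Scope ereal_scope.

Lemma wU_le_of_inequality (h : R -> \bar R) (x a J : R) :
  measurable_fun (`]0%R, +oo[ : set R) h -> (forall s, 0 <= h s) ->
  (0 <= J)%R -> \int[mu]_(z in `]0%R, +oo[) (h z * (v z)%:E) <= J%:E ->
  (0 < x)%R -> (0 <= a)%R -> a%:E <= average u p (tail h) x ->
  wU p u w x * (a `^ p^-1)%:E <= (c * J)%:E.
Proof.
move=> mh h0 J0 hJ x0 a0 ax.
apply: (wU_average_le wu U_gt0 aU p_gt0 _ _ ww x0 a0 _ ax).
- by move=> s s0; exact: tail_ge0.
- by move=> s t s0 st; exact: tail_nonincreasing.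
- exact: mulr_ge0.
apply: le_trans (ineq mh (fun t _ => h0 t)) _.
by rewrite EFinM; apply: lee_wpmul2l.
Qed.

(** Testing with unit mass beyond t: the tail is at least 1 on (0, t], so the average at x is at
    least U(t) / U(x). *)
Lemma wU_vbar_le (t x beta : R) : (0 < t <= x)%R -> (0 < beta)%R ->
  (beta^-1)%:E < vbar v `]t, +oo[ ->
  wU p u w x * ((U t / U x) `^ p^-1)%:E <= (c * beta)%:E.
Proof.
move=> /andP[t0 tx] b0 /(unit_tail_exists wv t0 b0)[h [mh h0 ht hv]].
have x0 : (0 < x)%R by exact: lt_le_trans tx.
have Ux := U_gt0 x0; have Ut := U_gt0 t0.
apply: (wU_le_of_inequality mh h0 (ltW b0) hv x0); first by rewrite divr_ge0 ?ltW.
rewrite averageE// mulrC EFinM; apply: lee_wpmul2l.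
  by rewrite lee_fin invr_ge0 ltW.
have th0 s : (0 < s)%R -> 0 <= tail h s by move=> s0; exact: tail_ge0.
have tn s r : (0 < s)%R -> (s <= r)%R -> tail h r <= tail h s.
  by move=> s0 sr; exact: tail_nonincreasing.
apply: (@le_trans _ _ (weighted_integral u p (tail h) t)); last first.
  by apply: weighted_integral_le; rewrite // t0.
rewrite -[leLHS]mul1e -(@poweR1r _ p).
apply: weighted_integral_ge => // s /andP[s0 /ltW st].
by apply: ht; rewrite s0.
Qed.

Section fixed_point.
Variables (x : R) (y : nat -> R).
Hypotheses (x_gt0 : (0 < x)%R)
  (y_grid : forall k, (0 < y k <= x)%R /\ U (y k) = (U x / 2 ^+ k)%R)
  (vbar_fin : forall k, vbar v `](y k.+1), +oo[ < +oo).

Let b k := fine (vbar v `](y k.+1), +oo[).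

Let y0 k : (0 < y k)%R. Proof. by have [/andP[]] := y_grid k. Qed.

Let b0 k : (0 < b k)%R.
Proof. by rewrite fine_gt0// vbar_fin andbT vbar_gt0// ltW. Qed.

Let yS k : (y k.+1 <= y k)%R.
Proof.
apply/ltW/(primitive_lt_inv aU); first exact: ltW.
have [_ ->] := y_grid k; have [_ ->] := y_grid k.+1.
rewrite ltr_pM2l ?U_gt0// ltf_pV2 ?posrE ?exprn_gt0//.
by rewrite ltr_eXn2l// ltr1n.
Qed.

(** On [y_(k+2), y_(k+1)) the function H is at least m_k, and U increases there by U(x) / 2^(k+2);
    this is where the 4 comes from. *)
Lemma average_grid_ge (H : R -> \bar R) (m : nat -> R) N :
  (forall s, (0 < s)%R -> 0 <= H s) ->
  (forall s t, (0 < s)%R -> (s <= t)%R -> H t <= H s) ->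
  (forall k, 0 <= m k)%R ->
  (forall k s, (k < N)%N -> (0 < s <= y k.+1)%R -> (m k)%:E <= H s) ->
  ((\sum_(0 <= k < N) 2 ^- k * m k `^ p) / 4)%:E <= average u p H x.
Proof.
move=> H0 Hn m0 hm; have Ux := U_gt0 x_gt0.
have key n : (n <= N)%N ->
    ((\sum_(0 <= k < n) 2 ^- k * m k `^ p) / 4 * U x)%:E +
    weighted_integral u p H (y n.+1) <= weighted_integral u p H (y 1%N).
  elim: n => [_|n ih nN]; first by rewrite big_geq// !mul0r add0e.
  apply: le_trans (ih (ltnW nN)); rewrite big_nat_recr//= !mulrDl EFinD -addeA.
  rewrite leeD2l//.
  have st : (0 < y n.+2 <= y n.+1)%R by rewrite y0 yS.
  have mn0 : 0 <= (m n)%:E by rewrite lee_fin.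
  have := @weighted_integral_step_ge _ u p wu U_gt0 p_gt0 H Hn _ _ _ st mn0.
  move=> hs; apply: le_trans (hs _); last first.
    move=> r /andP[yr ry]; apply: hm => //; rewrite (ltW ry) andbT.
    exact: lt_le_trans yr.
  rewrite addeC leeD2l//.
  have [_ ->] := y_grid n.+2; have [_ ->] := y_grid n.+1.
  rewrite poweR_EFin -EFinM lee_fin le_eqVlt; apply/orP; left; apply/eqP.
  by rewrite !exprS; field; rewrite expf_neq0.
rewrite averageE// -[X in X%:E](mulfK (lt0r_neq0 Ux)) mulrC EFinM.
apply: lee_wpmul2l; first by rewrite lee_fin invr_ge0 ltW.
apply: (@le_trans _ _ (weighted_integral u p H (y 1%N))); last first.
  by apply: weighted_integral_le; rewrite ?y0//; have [/andP[_ ->]] := y_grid 1.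
by apply: le_trans (key N (leqnn N)); rewrite leeDl// weighted_integral_ge0.
Qed.

(** The exponent of [m] is chosen so that, by (1 + q) p = q, both 2^-k m_k^p and m_k / b_k equal the
    k-th term of [sg]. The inequality then bounds W (sg / 4)^(1/p) by 2 c sg, and 1/p - 1 = 1/q. *)
Lemma wU_sum_vbar_le N : (p < 1)%R ->
  wU p u w x * ((\sum_(0 <= k < N)
     (2 ^- k) `^ (pstar p / p) * b k `^ pstar p) `^ (pstar p)^-1)%:E <=
  (2 * 4 `^ p^-1 * c)%:E.
Proof.
move=> p1; set q := pstar p.
have p1' : (0 < 1 - p)%R by rewrite subr_gt0.
have q0 : (0 < q)%R by rewrite divr_gt0.
have qp : (q / p = 1 + q)%R by rewrite /q /pstar; field; rewrite !gt_eqF.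
rewrite qp; set sg := (\sum_(0 <= k < N) _)%R.
have C0 : (0 <= 2 * 4 `^ p^-1 * c)%R by rewrite !mulr_ge0// powR_ge0.
have s0' : (0 <= sg)%R by apply: sumr_ge0 => k _; rewrite mulr_ge0 ?powR_ge0.
have [sg0|sgn0] := eqVneq sg 0%R.
  by rewrite sg0 powR0 ?invr_neq0 ?gt_eqF// mule0 lee_fin.
have s0 : (0 < sg)%R by rewrite lt0r sgn0.
pose m k := ((2 ^- k * b k) `^ (1 + q))%R.
have m0 k : (0 <= m k)%R by rewrite powR_ge0.
have be0 k : (0 < 2 / b k)%R by rewrite divr_gt0.
have e0 k : (0 < 2 ^- k :> R)%R by rewrite invr_gt0 exprn_gt0.
(* The factor 2 makes b_k / 2 strictly smaller than the essential supremum b_k, which need not be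
   attained. *)
have hb k : ((2 / b k)^-1)%:E < vbar v `](y k.+1), +oo[.
  rewrite -[ltRHS](@fineK _ (vbar v _)); last first.
    by rewrite ge0_fin_numE ?vbar_fin// ltW// vbar_gt0// ltW.
  by rewrite lte_fin invf_div ltr_pdivrMr// ltr_pMr ?ltr1n.
have [h [mh h0 ht hv]] := tail_minorant_exists wv N (fun k => y0 k.+1) m0 be0 hb.
have mp i : (2 ^- i * m i `^ p = (2 ^- i) `^ (1 + q) * b i `^ q)%R.
  have mE : (m i `^ p = (2 ^- i * b i) `^ q)%R.
    rewrite /m -powRrM; congr (_ `^ _)%R.
    by rewrite /q /pstar; field; rewrite !gt_eqF.
  rewrite mE powRM ?(ltW (b0 i)) ?(ltW (e0 i))//.
  rewrite [((2 ^- i) `^ (1 + q))%R]powRD; last by apply/implyP => _; rewrite gt_eqF ?e0.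
  by rewrite powRr1 ?(ltW (e0 i))// mulrA.
have mb i : (m i * (2 / b i) = 2 * ((2 ^- i) `^ (1 + q) * b i `^ q))%R.
  rewrite /m powRM ?(ltW (b0 i)) ?(ltW (e0 i))//.
  rewrite [(b i `^ (1 + q))%R]powRD; last first.
    by apply/implyP => _; rewrite gt_eqF ?b0.
  by rewrite powRr1 ?(ltW (b0 i))//; field; rewrite gt_eqF.
have := @wU_le_of_inequality h x (sg / 4) (2 * sg) mh h0.
rewrite mulr_ge0// divr_ge0// => /(_ isT) hW.
have {hW} : wU p u w x * ((sg / 4) `^ p^-1)%:E <= (c * (2 * sg))%:E.
  apply: hW => //.
    apply: (le_trans hv); rewrite lee_fin mulr_sumr.
    by apply: ler_sum => k _; rewrite mb.
  rewrite /sg; under eq_bigr do rewrite -mp.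
  apply: average_grid_ge => //.
  - by move=> s s0''; exact: tail_ge0.
  - by move=> s t s0'' st; exact: tail_nonincreasing.
have K0 : (0 < 4 `^ p^-1 / sg)%R by rewrite divr_gt0 ?powR_gt0.
have K0' : 0 <= (4 `^ p^-1 / sg)%:E by rewrite lee_fin ltW.
move=> /(lee_wpmul2r K0'); rewrite -muleA -!EFinM.
have -> : ((sg / 4) `^ p^-1 * (4 `^ p^-1 / sg) = sg `^ q^-1)%R.
  rewrite mulrA -powRM ?divr_ge0// divfK//.
  rewrite -[in LHS](powR_inv1 s0') -powRD; last by rewrite sgn0 implybT.
  by congr (_ `^ _)%R; rewrite /q /pstar; field; rewrite !gt_eqF.
move=> /le_trans; apply; rewrite lee_fin le_eqVlt; apply/orP; left; apply/eqP.
by field.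
Qed.

End fixed_point.
End necessity.

(** * Discretisation of the Stieltjes integral *)

Section vbar_left.
Context {R : realType} (v : R -> R).
Local Open Scope ereal_scope.

Lemma is_cvg_vbar t : cvg (vbar v `]s, +oo[ @[s --> t^'-]).
Proof.
apply/cvg_ex; eexists; apply/cvg_at_leftNP.
apply: (@nondecreasing_at_right_cvge _ _ _ (BInfty _ false) isT).
by move=> x y _ _ xy; apply: vbar_nonincreasing; rewrite lerN2.
Qed.

(** With [vbar_left_le], this replaces left limits by values of [vbar]; moving to the next grid
    point absorbs the difference. *)
Lemma vbar_left_ge t : vbar v `]t, +oo[ <= vbar_left v t.
Proof.
apply: lime_ge; first exact: is_cvg_vbar.
near=> s; apply: vbar_nonincreasing.
by near: s; exact: nbhs_left_le.
Unshelve. all: by end_near. Qed.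

Lemma vbar_left_le s t : (s < t)%R -> vbar_left v t <= vbar v `]s, +oo[.
Proof.
move=> st; apply: lime_le; first exact: is_cvg_vbar.
near=> r; apply: vbar_nonincreasing.
by near: r; exact: nbhs_left_ge.
Unshelve. all: by end_near. Qed.

End vbar_left.

Section stieltjes.
Context {R : realType}.
Local Open Scope ereal_scope.
Variable G : R -> \bar R.
Hypothesis GP : dec_lcont G.

(** Exhaust the ray by [y, y + n + 1), of mass G(y) - G(y + n + 1) <= G(y), and use continuity from
    below. *)
Lemma dneg_ray_le y : (0 < y)%R -> (forall t, (0 < t)%R -> 0 <= G t) ->
  dneg G `[y, +oo[ <= G y.
Proof.
move=> y0 G0; pose F (n : nat) : set R := `[y, (y + n.+1%:R)%R[%classic.
have -> : `[y, +oo[%classic = \bigcup_n F n.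
  apply/seteqP; split => s /=; last first.
    by move=> [n _] /=; rewrite !in_itv/= andbT => /andP[].
  rewrite in_itv/= andbT => ys; exists (Num.bound (s - y)) => //=.
  rewrite /F/= in_itv/= ys -ltrBlDl/=.
  apply: (lt_le_trans (archi_boundP _)); first by rewrite subr_ge0.
  by rewrite ler_nat.
have mF n : measurable (F n) by exact: measurable_itv.
have cF := nondecreasing_cvg_mu (mu := dneg G) mF (bigcupT_measurable F mF).
have {}cF : dneg G \o F @ \oo --> dneg G (\bigcup_n F n).
  apply: cF => m n mn; apply/subsetPset => s; rewrite /F/= !in_itv/=.
  by move=> /andP[-> /lt_le_trans]; apply; rewrite lerD2l ler_nat.
rewrite -(cvg_lim _ cF)//; apply: lime_le; first by apply/cvg_ex; eexists; exact: cF.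
apply: nearW => n; rewrite /= dneg_itv ?ltrDl//.
have [Gf _ _] := GP; have yn : (0 < y + n.+1%:R)%R by rewrite addr_gt0.
by rewrite leeBlDr ?Gf// leeDl// G0.
Qed.

(** As soon as G(b) <= e, the interval [y, b) carries mass at least G(y) - e. Decay of [vbar] at
    infinity enters the proof through this bound. *)
Lemma dneg_ray_ge y : (0 < y)%R ->
  (forall e, (0 < e)%R -> exists2 b, (y < b)%R & G b <= e%:E) ->
  G y <= dneg G `[y, +oo[.
Proof.
move=> y0 G0; have [Gf _ _] := GP; apply/lee_addgt0Pr => e /G0[b yb Gb].
have b0 : (0 < b)%R by exact: lt_trans yb.
have -> : G y = dneg G `[y, b[ + G b.
  by rewrite dneg_itv// subeK// Gf.
apply: leeD => //; apply: le_measure; rewrite ?inE; first exact: measurable_itv.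
  exact: measurable_itv.
by move=> s /=; rewrite !in_itv/= andbT => /andP[].
Qed.

End stieltjes.

Lemma measurable_nondecreasing_ray {R : realType} (f : R -> \bar R) (a : R) :
  (forall s t : R, a <= s -> s <= t -> (f s <= f t)%E) ->
  measurable_fun (`[a, +oo[ : set R) f.
Proof.
move=> fn mD; apply: (measurability _ (ErealGenCInfty.measurableE R)) => //.
move=> _ [_ [c ->] <-]; apply: is_interval_measurable => s t/=.
rewrite !in_itv/= !andbT => -[s0 cs] [t0 ct] z /andP[sz zt].
have z0 : a <= z by exact: le_trans sz.
split; first by rewrite /= in_itv/= z0.
by rewrite /= in_itv/= andbT (le_trans cs)// fn.
Qed.

Section vbar_integral.
Context {R : realType} (u v : R -> R) (q r : R).
Local Notation mu := (@lebesgue_measure R).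
Local Notation U := (primitive u).
Hypotheses (wv : weight v) (U_gt0 : forall t, 0 < t -> 0 < U t)
  (aU : admissible U) (q_gt0 : 0 < q) (r_gt0 : 0 < r).
Local Open Scope ereal_scope.
Hypotheses (vbar_fin : forall t, (0 < t)%R -> vbar v `]t, +oo[ < +oo).
Variables (x : R) (y : nat -> R).
Hypotheses (x_gt0 : (0 < x)%R)
  (y_grid : forall k, (0 < y k <= x)%R /\ U (y k) = (U x / 2 ^+ k)%R).

Let b k := fine (vbar v `](y k.+1), +oo[).
Let G t := vbar_left v t `^ q.
Let f t := (cal U t x `^ r)%:E.
Let rho := ((2^-1) `^ r)%R.

Let GP : dec_lcont G. Proof. exact: dec_lcont_vbar. Qed.

Let y0 k : (0 < y k)%R. Proof. by have [/andP[]] := y_grid k. Qed.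

Let Uy k : U (y k) = (U x / 2 ^+ k)%R. Proof. by have [] := y_grid k. Qed.

Let rho0 : (0 < rho)%R. Proof. by rewrite powR_gt0// invr_gt0. Qed.

Let rhoE k : ((2 ^- k) `^ r = rho ^+ k)%R.
Proof. by rewrite -exprVn powR_exprn// invr_ge0. Qed.

Let rho1 : (rho < 1)%R.
Proof.
have <- : (1 `^ r = 1 :> R)%R by rewrite powR1.
by apply: gt0_ltr_powR; rewrite ?nnegrE//; lra.
Qed.

Let vbar_left_ge0 t : (0 < t)%R -> 0 <= vbar_left v t.
Proof.
by move=> t0; apply: le_trans (vbar_left_ge v t); rewrite ltW// vbar_gt0// ltW.
Qed.

Let bE k : (b k `^ q)%:E = vbar v `](y k.+1), +oo[ `^ q.
Proof.
by rewrite -poweR_EFin fineK// ge0_fin_numE ?vbar_fin// ltW// vbar_gt0// ltW.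
Qed.

Let vbar_ge0 k : 0 <= vbar v `](y k.+1), +oo[.
Proof. by rewrite ltW// vbar_gt0// ltW. Qed.

Let U0 t : (0 <= t)%R -> (0 <= U t)%R.
Proof.
rewrite le_eqVlt => /predU1P[<-|t0]; last by rewrite ltW// U_gt0.
by case: aU => _ _ -> _.
Qed.

Let cal_homo s t : (0 <= s)%R -> (s <= t)%R -> (cal U s x <= cal U t x)%R.
Proof.
move=> s0 st; have t0 := le_trans s0 st; have Ux := U_gt0 x_gt0.
have Us := U0 s0; have Ut := U0 t0; have Ust := primitive_le aU s0 st.
rewrite /cal ler_pdivrMr ?ltr_wpDr// mulrAC ler_pdivlMr ?ltr_wpDr//.
by rewrite !mulrDr [(U t * U s)%R]mulrC lerD2r ler_pM2r.
Qed.

Let cal_ge0 t : (0 <= t)%R -> (0 <= cal U t x)%R.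
Proof.
by move=> t0; rewrite divr_ge0 ?addr_ge0 ?U0// ltW.
Qed.

Let f_ge0 t : 0 <= f t. Proof. by rewrite lee_fin powR_ge0. Qed.

Let mf : measurable_fun (`[0%R, +oo[ : set R) f.
Proof.
apply: measurable_nondecreasing_ray => s t s0 st; rewrite lee_fin.
have t0 := le_trans s0 st.
by apply: ge0_ler_powR; rewrite ?nnegrE ?cal_ge0 ?(ltW r_gt0)// cal_homo.
Qed.

(** Summed over k, these steps are comparable to [f], because cal(y_k, x) is about 2^-k. The
    integral of one step is rho^k times the mass of a ray, so about rho^k G(y_k). *)
Let step k (t : R) : \bar R :=
  (rho ^+ k)%:E * (\1_(`[(y k), +oo[ : set R) t)%:E.

Let step_ge0 k t : 0 <= step k t.
Proof. by rewrite mule_ge0 ?lee_fin// exprn_ge0// ltW. Qed.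

Let stepE k t : step k t = ((rho ^+ k * (y k <= t)%R%:R)%R)%:E.
Proof. by rewrite /step indicE mem_setE in_itv/= andbT EFinM. Qed.

Let mstep k (D : set R) : measurable_fun D (step k).
Proof.
apply: emeasurable_funM; first exact: measurable_cst.
apply/measurable_EFinP; apply: measurable_funTS.
exact: measurable_indic.
Qed.

Let integral_step k :
  \int[dneg G]_(t in `[0%R, +oo[) step k t = (rho ^+ k)%:E * dneg G `[(y k), +oo[.
Proof.
rewrite ge0_integralZl//; last 2 first.
- apply/(@measurable_EFinP _ _ _ _ \1__); apply: measurable_funTS.
  exact: measurable_indic.
- by rewrite lee_fin exprn_ge0// ltW.
rewrite integral_indic//= setIidl// => t /=; rewrite !in_itv/= !andbT.
by apply: le_trans; rewrite ltW.
Qed.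

(** For y_(k+1) <= t < y_k one has cal(t, x) <= 2^-k, so f(t) <= rho^k, which is 1 / rho times the
    step of index k+1; 1 / rho is the factor 2^r. The ray from y_k has mass at most G(y_k) <= b_k^q,
    as y_(k+1) < y_k. *)
Lemma vbar_integral_le (S : R) :
  (forall N, \sum_(0 <= k < N) (2 ^- k) `^ r * b k `^ q <= S)%R ->
  vbar_integral v q f <= (2 `^ r * S)%:E.
Proof.
move=> hS; rewrite /vbar_integral; case: asboolP => [[t t0 tb]|_].
  by have := vbar_fin t0; rewrite tb ltxx.
have rV : (2 `^ r = rho^-1)%R.
  by rewrite /rho -powR_inv1 ?invr_ge0// -powRrM mulrC powRrM powR_inv1 ?invr_ge0// invrK.
apply: (@le_trans _ _ (\int[dneg G]_(t in `[0%R, +oo[)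
    ((rho^-1)%:E * \sum_(0 <= k <oo) step k t))).
  apply: ge0_le_integral => //.
    apply: emeasurable_funM; first exact: measurable_cst.
    by apply: (@ge0_emeasurable_sum _ _ _ _ step xpredT) => k // t _; exact: mstep.
  move=> t /=; rewrite in_itv/= andbT le_eqVlt => /predU1P[<-|t0].
    (* No grid point lies below t = 0, but [f] vanishes there because U(0) = 0. *)
    rewrite /f /cal; case: (aU) => _ _ -> _; rewrite mul0r powR0 ?gt_eqF//.
    rewrite mule_ge0 ?lee_fin ?invr_ge0 ?(ltW rho0)//; exact: nneseries_ge0.
  suff [k [yk fk]] : exists k,
      (y k <= t)%R /\ (cal U t x `^ r <= rho^-1 * rho ^+ k)%R.
    apply: (@le_trans _ _ ((rho^-1)%:E * step k t)).
      by rewrite stepE yk mulr1 -EFinM lee_fin.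
    apply: lee_wpmul2l; first by rewrite lee_fin invr_ge0 ltW.
    exact: (@le_nneseries_term _ (step ^~ t)).
  have Ux := U_gt0 x_gt0; have Ut := U_gt0 t0.
  have c0 : (0 <= cal U t x)%R by rewrite cal_ge0// ltW.
  have [xt|tx] := leP x t.
    exists 0%N; split; first by have [/andP[_ yx] _] := y_grid 0; exact: le_trans xt.
    rewrite expr0 mulr1; apply: (@le_trans _ _ 1%R).
      have <- : (1 `^ r = 1 :> R)%R by rewrite powR1.
      apply: ge0_ler_powR; rewrite ?nnegrE ?(ltW r_gt0)//.
      by rewrite /cal ler_pdivrMr ?addr_gt0// mul1r lerDr ltW.
    by rewrite invf_ge1// ltW.
  have [|k /andP[k1 k2]] := @grid_index _ (U x) (U t) Ut.
    by apply: primitive_lt => //; exact: ltW.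
  exists k.+1; split.
    rewrite leNgt; apply/negP => /(primitive_lt aU (ltW t0)).
    by rewrite Uy ltNge k1.
  rewrite exprS mulKf ?gt_eqF// -rhoE.
  apply: ge0_ler_powR; rewrite ?nnegrE ?(ltW r_gt0) ?invr_ge0 ?exprn_ge0//.
  rewrite /cal ler_pdivrMr ?addr_gt0//; apply: (le_trans (ltW k2)).
  by rewrite mulrC ler_pM2l ?invr_gt0 ?exprn_gt0// lerDl ltW.
rewrite ge0_integralZl//; last 3 first.
- by apply: (@ge0_emeasurable_sum _ _ _ _ step xpredT) => k // t _; exact: mstep.
- by move=> t _; exact: nneseries_ge0.
- by rewrite lee_fin invr_ge0 ltW.
rewrite rV EFinM; apply: lee_wpmul2l; first by rewrite lee_fin invr_ge0 ltW.
rewrite integral_nneseries//; apply: nneseries_le => [k|N].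
  exact: integral_ge0.
apply: le_trans (_ : (_%:E <= S%:E)); last by rewrite lee_fin; exact: hS N.
rewrite -sumEFin; apply: lee_sum => k _; rewrite integral_step rhoE EFinM.
apply: lee_wpmul2l; first by rewrite lee_fin exprn_ge0// ltW.
apply: (le_trans (dneg_ray_le GP _ _)) => //.
  by move=> t _; exact: poweR_ge0.
rewrite bE; apply: le_poweR; rewrite ?(ltW q_gt0) ?vbar_left_ge0//.
apply: vbar_left_le; apply: (primitive_lt_inv aU); first exact: ltW.
by rewrite !Uy ltr_pM2l ?U_gt0// ltf_pV2 ?posrE ?exprn_gt0// ltr_eXn2l// ltr1n.
Qed.

(** Let m be least with y_(m+1) <= t. The steps of index k+1 sum at t to at most rho^(m+1) / (1 -
    rho), whereas cal(t, x) >= 2^-(m+2), so f(t) >= rho^(m+2). One factor rho is lost here and one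
    by the shift from k to k+1. *)
Lemma vbar_integral_ge N : vbar v `]t, +oo[ @[t --> +oo%R] --> 0 ->
  (rho ^+ 2 * (1 - rho) * \sum_(0 <= k < N) (2 ^- k) `^ r * b k `^ q)%:E <=
  vbar_integral v q f.
Proof.
move=> vlim; rewrite /vbar_integral; case: asboolP => [_|_]; first exact: leey.
have r10 : (0 < 1 - rho)%R by rewrite subr_gt0.
have Gsmall z (e : R) : (0 < e)%R -> exists2 B, (z < B)%R & G B <= e%:E.
  move=> e0; have e1 : 0 < (e `^ q^-1)%:E by rewrite lte_fin powR_gt0.
  have [M [_ hM]] : \forall t \near +oo%R, vbar v `]t, +oo[ < (e `^ q^-1)%:E.
    exact: (vlim _ (open_ereal_lt' e1)).
  pose t : R := (Num.max (Num.max z M + 1) 1)%R.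
  have tM : (M < t)%R by rewrite lt_max ltr_pwDr// le_max lexx orbT.
  have tz : (z < t)%R by rewrite lt_max ltr_pwDr// le_max lexx.
  have t0 : (0 < t)%R by rewrite lt_max ltr01 orbT.
  (* The left limit at t + 1 is bounded by the value of [vbar] at the smaller point t. *)
  exists (t + 1)%R; first by rewrite ltr_wpDr.
  have -> : e%:E = (e `^ q^-1)%:E `^ q.
    by rewrite poweR_EFin -powRrM mulVf ?gt_eqF// powRr1// ltW.
  apply: le_poweR; rewrite ?(ltW q_gt0) ?vbar_left_ge0 ?addr_gt0//.
  apply: le_trans (ltW (hM t tM)); apply: vbar_left_le; rewrite ltrDl//.
pose kap := (rho ^+ 2 * (1 - rho))%R.
have kap0 : (0 < kap)%R by rewrite mulr_gt0// exprn_gt0.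
apply: (@le_trans _ _ (\int[dneg G]_(t in `[0%R, +oo[)
    ((kap / rho)%:E * \sum_(0 <= k < N) step k.+1 t))).
  rewrite ge0_integralZl//; last 3 first.
  - by apply: emeasurable_sum => k; exact: mstep.
  - by move=> t _; exact: sume_ge0.
  - by rewrite lee_fin divr_ge0 ?ltW.
  rewrite ge0_integral_sum//.
  rewrite -/kap; set sm := (\sum_(0 <= k < N) _)%R.
  have -> : (kap * sm = kap / rho * (rho * sm))%R.
    by rewrite mulrA divfK// gt_eqF.
  rewrite EFinM /sm.
  apply: lee_wpmul2l; first by rewrite lee_fin divr_ge0 ?ltW.
  rewrite mulr_sumr -sumEFin; apply: lee_sum => k _.
  rewrite integral_step rhoE mulrA -exprS EFinM.
  apply: lee_wpmul2l; first by rewrite lee_fin exprn_ge0// ltW.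
  apply: (@le_trans _ _ (G (y k.+1))); last first.
    by apply: dneg_ray_ge => // e; exact: Gsmall.
  by rewrite bE; apply: le_poweR; rewrite ?(ltW q_gt0)//; exact: vbar_left_ge.
apply: ge0_le_integral => //.
- move=> t _; rewrite mule_ge0 ?sume_ge0// lee_fin divr_ge0// ltW//.
- apply: emeasurable_funM; first exact: measurable_cst.
  by apply: emeasurable_sum => k; exact: mstep.
move=> t /=; rewrite in_itv/= andbT => t0.
under eq_bigr do rewrite stepE.
rewrite sumEFin -EFinM lee_fin.
have [[k0 /andP[k0N yk0]]|nex] :=
  pselect (exists k, (k < N)%N && (y k.+1 <= t)%R); last first.
  rewrite big_nat big1 ?mulr0 ?powR_ge0// => k /andP[_ kN].
  have [yt|] := leP (y k.+1) t; last by rewrite mulr0.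
  by exfalso; apply: nex; exists k; rewrite kN.
have ex : exists k, (k < N)%N && (y k.+1 <= t)%R by exists k0; rewrite k0N.
case: (ex_minnP ex) => m /andP[mN ym] mmin.
apply: (@le_trans _ _ (kap / rho * (rho * (rho ^+ m / (1 - rho))))%R).
  rewrite ler_pM2l ?divr_gt0// (@big_cat_nat _ _ _ m)//=; last exact: ltnW.
  rewrite big_nat big1 ?add0r => [|k /andP[_ km]]; last first.
    have [yt|] := leP (y k.+1) t; last by rewrite mulr0.
    by move: (mmin k); rewrite yt (ltn_trans km mN) => /(_ isT); rewrite leqNgt km.
  apply: (@le_trans _ _ (rho * \sum_(m <= k < N) rho ^+ k)%R).
    rewrite mulr_sumr; apply: ler_sum => k _; rewrite exprS ler_piMr ?lern1//.
      by rewrite mulr_ge0 ?exprn_ge0 ?ltW.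
    by case: leP.
  by rewrite ler_pM2l//; apply: geometric_sum_le; rewrite rho0.
have -> : (kap / rho * (rho * (rho ^+ m / (1 - rho))) = rho ^+ m.+2)%R.
  by rewrite /kap !exprS; field; rewrite !gt_eqF.
rewrite -rhoE; apply: ge0_ler_powR;
  rewrite ?nnegrE ?(ltW r_gt0) ?cal_ge0 ?invr_ge0 ?exprn_ge0//.
apply: le_trans (cal_homo _ ym); last exact: ltW.
have Ux := U_gt0 x_gt0.
rewrite /cal Uy ler_pdivlMr ?addr_gt0 ?divr_gt0 ?exprn_gt0//.
rewrite mulrDr [(2 ^+ m.+2)%R]exprS invfM.
have e0 : (0 < 2 ^- m.+1 :> R)%R by rewrite invr_gt0 exprn_gt0.
have e1 : (2 ^- m.+1 <= 1 :> R)%R.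
  by rewrite invf_le1 ?exprn_gt0// exprn_ege1// ler1n.
have : (0 <= (U x * 2 ^- m.+1) * (1 - 2 ^- m.+1))%R.
  by rewrite !mulr_ge0 ?subr_ge0 ?(ltW Ux) ?(ltW e0).
lra.
Qed.

End vbar_integral.

(** * Best constants *)

Section best_constant.
Context {R : realType} (p : R) (u v w : R -> R).
Hypothesis wv : weight v.
Local Open Scope ereal_scope.

(** The logic common to both ranges of p, with kA from necessity and kB from sufficiency.
    Sufficiency is available for c > 0, so the case I = 0 is reached through c = I + e / kB with e
    arbitrarily small. *)
Lemma best_constant_equiv (I : \bar R) (kA kB lam : R) : 0 <= I ->
  (0 < kB)%R -> (kA <= lam)%R -> (kB <= lam)%R ->
  (forall c, (0 <= c)%R -> inequality p u v w c -> I <= (kA * c)%:E) ->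
  (forall c, (0 < c)%R -> I <= c%:E -> inequality p u v w (kB * c)) ->
  ((exists2 c : R, (0 <= c)%R & inequality p u v w c) <-> I < +oo) /\
  ((lam^-1)%:E * I <= best_constant p u v w /\
   best_constant p u v w <= lam%:E * I).
Proof.
move=> I0 kB0 kAl kBl hA hB; have l0 : (0 < lam)%R by exact: lt_le_trans kBl.
split; [split|split].
- by move=> [c c0 /(hA _ c0)/le_lt_trans]; apply; rewrite ltry.
- move=> Iy; have If : I \is a fin_num by rewrite ge0_fin_numE.
  have c0 : (0 < fine I + 1)%R by rewrite ltr_wpDl ?fine_ge0.
  exists (kB * (fine I + 1))%R; first by rewrite mulr_ge0// ltW.
  by apply: hB => //; rewrite -{1}(fineK If) lee_fin lerDl.
- apply: le_ereal_inf_tmp => _ [c [c0 /(hA _ c0) Ic] <-].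
  rewrite muleC lee_pdivrMr// -EFinM; apply: (le_trans Ic).
  by rewrite lee_fin mulrC ler_wpM2l.
- have [->|Iy] := eqVneq I +oo; first by rewrite gt0_muley ?lte_fin// leey.
  have If : I \is a fin_num by rewrite ge0_fin_numE// ltey.
  apply: (@le_trans _ _ (kB%:E * I)); last first.
    by apply: lee_wpmul2r => //; rewrite lee_fin.
  apply/lee_addgt0Pr => e e0.
  have c0 : (0 < fine I + e / kB)%R by rewrite ltr_wpDl ?fine_ge0 ?divr_gt0.
  apply: ereal_inf_lbound; exists (kB * (fine I + e / kB))%R; last first.
    rewrite -{2}(fineK If) -EFinM -EFinD; congr EFin.
    by rewrite mulrDr mulrCA divff ?mulr1// gt_eqF.
  split; first by rewrite mulr_ge0// ltW.
  apply: hB => //; rewrite -{1}(fineK If) lee_fin lerDl.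
  by rewrite ltW// divr_gt0.
Qed.

(** A real r strictly between K and [vbar] would make beta = 1 / r a test value violating the bound;
    this also excludes an infinite [vbar]. *)
Lemma vbar_le_of_test (t K : R) :
  (forall beta, (0 < beta)%R -> (beta^-1)%:E < vbar v `]t, +oo[ ->
    (1 <= K * beta)%R) -> (0 <= K)%R ->
  vbar v `]t, +oo[ <= K%:E.
Proof.
move=> hK K0; rewrite leNgt; apply/negP => Kv.
have [r Kr rv] : exists2 r : R, (K < r)%R & r%:E < vbar v `]t, +oo[.
  move: Kv; case: (vbar _ _) => [s| |]//.
    rewrite lte_fin => Ks; exists ((K + s) / 2)%R; first by rewrite midf_lt.
    by rewrite lte_fin midf_lt.
  by move=> _; exists (K + 1)%R; rewrite ?ltrDl// ltry.
have r0 : (0 < r)%R by exact: le_lt_trans Kr.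
have := hK r^-1%R; rewrite invr_gt0 invrK => /(_ r0 rv).
by rewrite ler_pdivlMr// mul1r leNgt Kr.
Qed.

End best_constant.

(** * Comparison of [I5] and [I6] with the constants of the inequality *)

Section bounds.
Context {R : realType} (p : R) (u v w : R -> R).
Local Notation U := (primitive u).
Hypotheses (wu : weight u) (wv : weight v) (ww : weight w)
  (U_gt0 : forall t, 0 < t -> 0 < U t) (aU : admissible U) (p_gt0 : 0 < p).
Local Open Scope ereal_scope.

Lemma wU_ge0 x : (0 < x)%R -> 0 <= wU p u w x.
Proof.
move=> x0; apply: ess_sup_itv_ge0; first by rewrite lebesgue_measure_ray.
move=> s; rewrite in_itv/= andbT => s0.
by rewrite mule_ge0 ?lee_fin ?powR_ge0//; exact: ww.2.
Qed.

Lemma I5_ge0 : 0 <= I5 p u v w.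
Proof.
apply: le_ereal_sup_tmp; eexists; first by exists 1%R; rewrite //= in_itv/= ltr01.
by rewrite mule_ge0 ?wU_ge0 ?poweR_ge0.
Qed.

Lemma I6_ge0 : 0 <= I6 p u v w.
Proof.
apply: le_ereal_sup_tmp; eexists; first by exists 1%R; rewrite //= in_itv/= ltr01.
rewrite !mule_ge0 ?wU_ge0 ?lee_fin ?powR_ge0//.
apply: le_ereal_sup_tmp; eexists.
  exists (2^-1)%R; last reflexivity.
  by rewrite /= in_itv/= invr_gt0 invf_lt1// ltr1n ltr0n.
by rewrite mule_ge0 ?lee_fin ?powR_ge0// ltW// vbar_gt0// invr_ge0.
Qed.

(** Optimises [wU_vbar_le] over beta. A single beta already shows that [wU] is finite, after which
    it can be divided out; if [wU] is 0 the product is 0 by convention. *)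
Lemma wU_mul_vbar_le (c t x : R) : (0 <= c)%R -> inequality p u v w c ->
  (0 < t <= x)%R ->
  wU p u w x * ((U t / U x) `^ p^-1)%:E * vbar v `]t, +oo[ <= c%:E.
Proof.
move=> c0 ineq tx; have /andP[t0 tx'] := tx.
have x0 : (0 < x)%R by exact: lt_le_trans tx'.
have a0 : (0 < (U t / U x) `^ p^-1)%R by rewrite powR_gt0// divr_gt0 ?U_gt0.
have W0 := wU_ge0 x0; have V0 : 0 < vbar v `]t, +oo[ by rewrite vbar_gt0// ltW.
have test beta := wU_vbar_le wu wv ww U_gt0 aU p_gt0 c0 ineq tx (beta := beta).
have [r r0 rV] : exists2 r : R, (0 < r)%R & (r^-1)%:E < vbar v `]t, +oo[.
  move: V0; case: (vbar _ _) => [s| |]// s0; last by exists 1%R; rewrite ?ltry.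
  exists (2 / s)%R; rewrite lte_fin in s0; first by rewrite divr_gt0.
  by rewrite lte_fin invf_div ltr_pdivrMr// ltr_pMr ?ltr1n.
have WF : wU p u w x \is a fin_num.
  rewrite ge0_fin_numE// ltey; apply/eqP => Wy; have := test _ r0 rV.
  by rewrite Wy gt0_mulye ?lte_fin.
move: W0 test; rewrite -(fineK WF) lee_fin le_eqVlt => /predU1P[<-|W0] test.
  by rewrite !mul0e lee_fin.
set wr := fine _ in W0 test *.
have wa : (0 < wr * (U t / U x) `^ p^-1)%R by rewrite mulr_gt0.
rewrite -EFinM muleC -lee_pdivlMr// -EFinM; apply: vbar_le_of_test => //.
  move=> beta b0 /(test _ b0); rewrite -EFinM lee_fin => h.
  by rewrite mulrAC ler_pdivlMr// mul1r.
by rewrite divr_ge0// ltW.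
Qed.

(** In [wU_mul_vbar_le] all factors are positive and the bound is finite, so none is infinite. The
    points t beyond x follow by monotonicity of [vbar]. *)
Lemma wU_vbar_finite (c x : R) : (0 <= c)%R -> inequality p u v w c ->
  (0 < x)%R -> 0 < wU p u w x ->
  wU p u w x < +oo /\ forall t, (0 < t)%R -> vbar v `]t, +oo[ < +oo.
Proof.
move=> c0 ineq x0 W0.
have a0 t : (0 < t)%R -> 0 < ((U t / U x) `^ p^-1)%:E.
  by move=> t0; rewrite lte_fin powR_gt0// divr_gt0 ?U_gt0.
have fin t : (0 < t <= x)%R -> vbar v `]t, +oo[ < +oo.
  move=> tx; have /andP[t0 _] := tx; rewrite ltey; apply/eqP => Vy.
  have := wU_mul_vbar_le c0 ineq tx.
  by rewrite Vy gt0_muley// mule_gt0// a0.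
split.
  rewrite ltey; apply/eqP => Wy; have xx : (0 < x <= x)%R by rewrite x0 lexx.
  have := wU_mul_vbar_le c0 ineq xx.
  by rewrite Wy gt0_mulye ?a0// gt0_mulye// vbar_gt0// ltW.
move=> t t0; have [tx|/ltW xt] := leP t x; first by apply: fin; rewrite t0.
apply: le_lt_trans (vbar_nonincreasing v xt) _.
by apply: fin; rewrite x0 lexx.
Qed.

Lemma I6_le (c : R) : (0 <= c)%R -> inequality p u v w c ->
  I6 p u v w <= c%:E.
Proof.
move=> c0 ineq; apply: ge_ereal_sup => _ [x /= + <-].
rewrite in_itv/= andbT => x0.
(* When [wU] vanishes the product is 0 even if the other factor is infinite; finiteness of [vbar] is
   known only in the positive case. *)
have /orP[/eqP W0|W0] : (0 == wU p u w x) || (0 < wU p u w x).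
- by rewrite -le_eqVlt wU_ge0.
- by rewrite -W0 !mul0e lee_fin.
have [Wy _] := wU_vbar_finite c0 ineq x0 W0.
have WF : wU p u w x \is a fin_num by rewrite ge0_fin_numE// ltW.
have Ux := U_gt0 x0.
have wr0 : (0 < fine (wU p u w x))%R by rewrite fine_gt0// W0.
have wa : (0 < fine (wU p u w x) * U x `^ (- p^-1))%R.
  by rewrite mulr_gt0// powR_gt0.
rewrite -{1}(fineK WF) -EFinM muleC -lee_pdivlMr// -EFinM.
apply: ge_ereal_sup => _ [t /= + <-]; rewrite in_itv/= => /andP[t0 tx].
rewrite EFinM lee_pdivlMr// EFinM fineK//.
have tx' : (0 < t <= x)%R by rewrite t0 ltW.
apply: le_trans (wU_mul_vbar_le c0 ineq tx').
rewrite powRM ?invr_ge0 ?(ltW Ux) ?(ltW (U_gt0 t0))//.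
rewrite -(powR_inv1 (ltW Ux)) -powRrM mulN1r EFinM.
by rewrite muleCA -!muleA [vbar _ _ * _]muleC !muleA muleAC.
Qed.

(** Evaluate [I6] at t = y_(k+1), where (U(t) / U(x))^(1/p) = rho^(k+1). This bounds rho^k b_k by D
    = c / (W rho); the index shift produces the factor 1 / rho, and [average_tail_ge1] the factor 1
    / (1 - rho). *)
Lemma inequality_I6 (c : R) : (1 <= p)%R -> (0 < c)%R ->
  I6 p u v w <= c%:E ->
  inequality p u v w
    (4 `^ p^-1 * (((2^-1) `^ p^-1 * (1 - (2^-1) `^ p^-1))^-1 * c)).
Proof.
move=> p1 c0 Ic; set rho := ((2^-1) `^ p^-1)%R.
have rho0 : (0 < rho)%R by rewrite powR_gt0// invr_gt0.
have rho1 : (rho < 1)%R.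
  have <- : (1 `^ p^-1 = 1 :> R)%R by rewrite powR1.
  by apply: gt0_ltr_powR; rewrite ?invr_gt0 ?nnegrE//; lra.
have r10 : (0 < 1 - rho)%R by rewrite subr_gt0.
have C0 : (0 < (rho * (1 - rho))^-1 * c)%R by rewrite mulr_gt0// invr_gt0 mulr_gt0.
apply: inequality_of_average => // h J x mh h0 J0 hJ x0.
have [y yg] := primitive_grid U_gt0 aU x0; have Ux := U_gt0 x0.
have /orP[/eqP W0|W0] : (0 == wU p u w x) || (0 < wU p u w x).
- by rewrite -le_eqVlt wU_ge0.
- by rewrite -W0 mul0e lee_fin mulr_ge0// ltW.
have hk k : wU p u w x * (rho ^+ k.+1)%:E * vbar v `](y k.+1), +oo[ <= c%:E.
  have [/andP[y0 yx] Uy] := yg k.+1.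
  have {}yx : (y k.+1 < x)%R.
    apply: (primitive_lt_inv aU); first exact: ltW.
    by rewrite Uy ltr_pdivrMr ?exprn_gt0// ltr_pMr// exprn_egt1// ltr1n.
  apply: le_trans Ic; apply: le_trans (ereal_sup_ubound _); last first.
    by exists x; first by rewrite /= in_itv/= x0.
  have -> : (rho ^+ k.+1 = U x `^ (- p^-1) * U (y k.+1) `^ p^-1)%R.
    rewrite Uy powRM ?(ltW Ux) ?invr_ge0 ?exprn_ge0// mulrA powRN mulVf ?mul1r.
      by rewrite -exprVn powR_exprn// invr_ge0.
    by rewrite gt_eqF// powR_gt0.
  rewrite EFinM !muleA -[leLHS]muleA; apply: lee_wpmul2l.
    by rewrite mule_ge0 ?(ltW W0)// lee_fin powR_ge0.
  by apply: ereal_sup_ubound; exists (y k.+1) => //; rewrite /= in_itv/= y0.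
have y0 k : (0 < y k)%R by have [/andP[]] := yg k.
have e0 k : 0 < (rho ^+ k)%:E by rewrite lte_fin exprn_gt0.
have Vf k : vbar v `](y k.+1), +oo[ < +oo.
  rewrite ltey; apply/eqP => Vy; have := hk k.
  by rewrite Vy gt0_muley// mule_gt0.
have Wf : wU p u w x \is a fin_num.
  rewrite ge0_fin_numE ?(ltW W0)// ltey; apply/eqP => Wy; have := hk 0%N.
  by rewrite Wy gt0_mulye// gt0_mulye// vbar_gt0// ltW.
have wr0 : (0 < fine (wU p u w x))%R by rewrite fine_gt0// W0 -ge0_fin_numE// ltW.
have D0 : (0 < c / (fine (wU p u w x) * rho))%R by rewrite divr_gt0// mulr_gt0.
have hD k : (rho ^+ k * fine (vbar v `](y k.+1), +oo[) <=
    c / (fine (wU p u w x) * rho))%R.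
  rewrite ler_pdivlMr ?mulr_gt0//; have := hk k.
  rewrite -(fineK Wf) -[vbar _ _]fineK; last first.
    by rewrite ge0_fin_numE ?Vf// ltW// vbar_gt0// ltW.
  rewrite -!EFinM lee_fin exprS; apply: le_trans; rewrite le_eqVlt.
  by apply/orP; left; apply/eqP; rewrite /rho; ring.
have := average_tail_ge1 wu wv U_gt0 aU p_gt0 x0 yg mh h0 J0 hJ Vf p1 D0 hD.
move=> /(lee_wpmul2l (ltW W0))/le_trans; apply.
rewrite -(fineK Wf) -EFinM lee_fin -/rho le_eqVlt; apply/orP; left; apply/eqP.
by field; rewrite !gt_eqF.
Qed.

Section lt1.
Hypothesis p_lt1 : (p < 1)%R.
Let q := pstar p.
Let r := (q / p)%R.

Let q0 : (0 < q)%R. Proof. by rewrite divr_gt0// subr_gt0. Qed.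
Let r0 : (0 < r)%R. Proof. by rewrite divr_gt0. Qed.

(** [wU_sum_vbar_le] bounds the dyadic sums by K^q with K = 2 4^(1/p) c / W, and [vbar_integral_le]
    carries this over to the integral at the cost of 2^r. *)
Lemma I5_le (c : R) : (0 <= c)%R -> inequality p u v w c ->
  I5 p u v w <= ((2 `^ r) `^ q^-1 * (2 * 4 `^ p^-1) * c)%:E.
Proof.
move=> c0 ineq; apply: ge_ereal_sup => _ [x /= + <-].
rewrite in_itv/= andbT => x0.
have /orP[/eqP W0|W0] : (0 == wU p u w x) || (0 < wU p u w x).
- by rewrite -le_eqVlt wU_ge0.
- by rewrite -W0 mul0e lee_fin !mulr_ge0 ?powR_ge0.
have [Wy Vy] := wU_vbar_finite c0 ineq x0 W0.
have WF : wU p u w x \is a fin_num by rewrite ge0_fin_numE// ltW.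
set wr := fine (wU p u w x); have wr0 : (0 < wr)%R by rewrite fine_gt0// W0.
have [y yg] := primitive_grid U_gt0 aU x0.
have y0 k : (0 < y k)%R by have [/andP[]] := yg k.
have Vyk k : vbar v `](y k.+1), +oo[ < +oo by exact: Vy.
have hN := wU_sum_vbar_le wu wv ww U_gt0 aU p_gt0 c0 ineq x0 yg Vyk _ p_lt1.
pose K := (2 * 4 `^ p^-1 * c / wr)%R.
have K0 : (0 <= K)%R by rewrite divr_ge0 ?mulr_ge0 ?powR_ge0// ltW.
have hS N : (\sum_(0 <= k < N) (2 ^- k) `^ r *
    fine (vbar v `](y k.+1), +oo[) `^ q <= K `^ q)%R.
  set sg := (\sum_(_ <= k < _) _)%R.
  have s0 : (0 <= sg)%R by apply: sumr_ge0 => k _; rewrite mulr_ge0 ?powR_ge0.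
  have : (sg `^ q^-1 <= K)%R.
    rewrite ler_pdivlMr// mulrC -lee_fin EFinM fineK//; exact: hN.
  move=> sK; rewrite -[leLHS](powRr1 s0) -(mulVf (lt0r_neq0 q0)) powRrM.
  by apply: ge0_ler_powR; rewrite ?nnegrE ?powR_ge0 ?(ltW q0).
have := vbar_integral_le wv U_gt0 aU q0 r0 Vy x0 yg hS.
move=> hV; apply: (@le_trans _ _ (wU p u w x * (2 `^ r * K `^ q)%:E `^ q^-1)).
  apply: lee_wpmul2l; first exact: ltW.
  apply: le_poweR => //; first by rewrite invr_ge0 ltW.
  rewrite /vbar_integral; case: asboolP => _; first exact: leey.
  by apply: integral_ge0 => t _; rewrite lee_fin powR_ge0.
rewrite -(fineK WF) poweR_EFin -EFinM lee_fin -/wr powRM ?powR_ge0//.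
rewrite -(powRrM K) mulfV ?gt_eqF// powRr1// /K le_eqVlt.
by apply/orP; left; apply/eqP; field; rewrite gt_eqF.
Qed.

Let rho := ((2^-1) `^ r)%R.
Let kap := (rho ^+ 2 * (1 - rho))%R.

(** Since W > 0, the integral is finite, and by its convention so is [vbar] on every ray. The first
    dyadic term shows that the integral is positive, so W is finite as well. Then [vbar_integral_ge]
    gives the sum bound that [average_tail_lt1] requires. *)
Lemma inequality_I5 (c : R) : vbar v `]t, +oo[ @[t --> +oo%R] --> 0 ->
  (0 < c)%R -> I5 p u v w <= c%:E ->
  inequality p u v w (4 `^ p^-1 * (4 `^ p^-1 * (kap^-1) `^ q^-1 * c)).
Proof.
move=> vlim c0 Ic.
have rho0 : (0 < rho)%R by rewrite powR_gt0// invr_gt0.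
have rho1 : (rho < 1)%R.
  have <- : (1 `^ r = 1 :> R)%R by rewrite powR1.
  by apply: gt0_ltr_powR; rewrite ?invr_gt0 ?nnegrE//; lra.
have kap0 : (0 < kap)%R by rewrite mulr_gt0 ?exprn_gt0// subr_gt0.
have C0 : (0 < 4 `^ p^-1 * (kap^-1) `^ q^-1 * c)%R.
  by rewrite !mulr_gt0 ?powR_gt0// invr_gt0.
apply: inequality_of_average => // h J x mh h0 J0 hJ x0.
have /orP[/eqP W0|W0] : (0 == wU p u w x) || (0 < wU p u w x).
- by rewrite -le_eqVlt wU_ge0.
- by rewrite -W0 mul0e lee_fin mulr_ge0// ltW.
have {Ic} : wU p u w x * vbar_integral v q
    (fun t => (cal U t x `^ r)%:E) `^ q^-1 <= c%:E.
  apply: le_trans Ic; apply: ereal_sup_ubound; exists x => //.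
  by rewrite /= in_itv/= x0.
set VI := vbar_integral _ _ _ => hc.
have VIy : VI < +oo.
  rewrite ltey; apply/eqP => VIy; move: hc.
  by rewrite VIy poweRyr ?invr_eq0 ?gt_eqF// gt0_muley.
have Vy t : (0 < t)%R -> vbar v `]t, +oo[ < +oo.
  move=> t0; rewrite ltey; apply/eqP => Vt; move: VIy.
  rewrite /VI /vbar_integral; case: asboolP => // -[]; by exists t.
have [y yg] := primitive_grid U_gt0 aU x0.
have y0 k : (0 < y k)%R by have [/andP[]] := yg k.
have Vyk k : vbar v `](y k.+1), +oo[ < +oo by exact: Vy.
have hN := vbar_integral_ge wv U_gt0 aU q0 r0 Vy x0 yg _ vlim.
have b0 k : (0 < fine (vbar v `](y k.+1), +oo[))%R.
  by rewrite fine_gt0// Vyk andbT vbar_gt0// ltW.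
have VI0 : 0 < VI.
  apply: lt_le_trans (hN 1%N); rewrite big_nat1 lte_fin mulr_gt0//.
  by rewrite mulr_gt0 ?powR_gt0// invr_gt0 exprn_gt0.
have WF : wU p u w x \is a fin_num.
  rewrite ge0_fin_numE ?(ltW W0)// ltey; apply/eqP => Wy; move: hc.
  by rewrite Wy gt0_mulye// poweR_gt0.
have VIf : VI \is a fin_num by rewrite ge0_fin_numE// ltW.
set wr := fine (wU p u w x).
have wr0 : (0 < wr)%R by rewrite fine_gt0// W0 -ge0_fin_numE// ltW.
pose K := (c / wr)%R; have K0 : (0 < K)%R by rewrite divr_gt0.
have VIK : (fine VI <= K `^ q)%R.
  have V0 : (0 <= fine VI)%R by rewrite fine_ge0// ltW.
  have : (fine VI `^ q^-1 <= K)%R.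
    rewrite ler_pdivlMr// mulrC -lee_fin EFinM -poweR_EFin !fineK//.
  move=> sK; rewrite -[leLHS](powRr1 V0) -(mulVf (lt0r_neq0 q0)) powRrM.
  by apply: ge0_ler_powR; rewrite ?nnegrE ?powR_ge0 ?(ltW q0) ?(ltW K0).
have S0 : (0 < kap^-1 * K `^ q)%R by rewrite mulr_gt0 ?invr_gt0// powR_gt0.
have hS N : (\sum_(0 <= k < N) (2 ^- k) `^ (pstar p / p) *
    fine (vbar v `](y k.+1), +oo[) `^ pstar p <= kap^-1 * K `^ q)%R.
  rewrite ler_pdivlMl//; apply: le_trans VIK; rewrite -lee_fin fineK//.
have := average_tail_lt1 wu wv U_gt0 aU p_gt0 x0 yg mh h0 J0 hJ Vyk p_lt1 S0 hS.
move=> /(lee_wpmul2l (ltW W0))/le_trans; apply.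
rewrite -(fineK WF) -EFinM lee_fin -/wr powRM ?invr_ge0 ?powR_ge0 ?(ltW kap0)//.
rewrite -/q -(powRrM K) mulfV ?gt_eqF// powRr1 ?(ltW K0)// /K le_eqVlt.
by apply/orP; left; apply/eqP; field; rewrite gt_eqF.
Qed.

End lt1.
End bounds.

Theorem theorem4p3 (R : realType) (p : R) (p_gt0 : 0 < p) :
  exists2 lam : R, 0 < lam &
  forall u v w : R -> R,
    weight u -> weight v -> weight w ->
    vbar v `]t, +oo[ @[t --> +oo] --> 0%E ->
    (forall t, 0 < t -> 0 < primitive u t) ->
    admissible (primitive u) ->
    nondegenerate_wrt (phi_uw p u w) (fun t => primitive u t `^ p^-1) ->
    (p < 1 ->
      ((exists2 c : R, 0 <= c & inequality p u v w c) <->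
       (I5 p u v w < +oo)%E) /\
      (((lam^-1)%:E * I5 p u v w <= best_constant p u v w)%E /\
       (best_constant p u v w <= lam%:E * I5 p u v w)%E)) /\
    (1 <= p ->
      ((exists2 c : R, 0 <= c & inequality p u v w c) <->
       (I6 p u v w < +oo)%E) /\
      (((lam^-1)%:E * I6 p u v w <= best_constant p u v w)%E /\
       (best_constant p u v w <= lam%:E * I6 p u v w)%E)).
Proof.
(* The case split comes before the choice of [lam], which may depend on p but is fixed before the
   weights. *)
have [p1|p1] := leP 1 p.
  set rho := (2^-1 : R) `^ p^-1.
  pose kB := 4 `^ p^-1 * (rho * (1 - rho))^-1.
  have rho0 : 0 < rho by rewrite powR_gt0// invr_gt0.
  have rho1 : rho < 1.
    have <- : (1 : R) `^ p^-1 = 1 by rewrite powR1.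
    by apply: gt0_ltr_powR; rewrite ?invr_gt0 ?nnegrE//; lra.
  have kB0 : 0 < kB by rewrite mulr_gt0 ?powR_gt0// invr_gt0 mulr_gt0// subr_gt0.
  exists (Num.max 1 kB); first by rewrite lt_max ltr01.
  move=> u v w wu wv ww _ U0 aU _; split=> // _.
  apply: (best_constant_equiv (kA := 1) (kB := kB)); rewrite ?le_max ?lexx ?orbT//.
  - exact: I6_ge0.
  - by move=> c c0 /(I6_le wu wv ww U0 aU p_gt0 c0); rewrite mul1r.
  - by move=> c c0 Ic; rewrite /kB -mulrA; exact: inequality_I6.
set q := pstar p; set r := q / p; set rho := (2^-1 : R) `^ r.
pose kap := rho ^+ 2 * (1 - rho).
(* [kA] is the constant of [I5_le] and [kB] that of [inequality_I5]. *)
pose kA := (2 `^ r) `^ q^-1 * (2 * 4 `^ p^-1).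
pose kB := 4 `^ p^-1 * (4 `^ p^-1 * kap^-1 `^ q^-1).
have r0 : 0 < r by rewrite !divr_gt0// subr_gt0.
have rho0 : 0 < rho by rewrite powR_gt0// invr_gt0.
have rho1 : rho < 1.
  have <- : (1 : R) `^ r = 1 by rewrite powR1.
  by apply: gt0_ltr_powR; rewrite ?invr_gt0 ?nnegrE//; lra.
have kB0 : 0 < kB.
  by rewrite !mulr_gt0 ?powR_gt0// invr_gt0 mulr_gt0 ?exprn_gt0// subr_gt0.
exists (Num.max kA kB); first by rewrite lt_max kB0 orbT.
move=> u v w wu wv ww vlim U0 aU _; split=> // _.
apply: (best_constant_equiv (kA := kA) (kB := kB)); rewrite ?le_max ?lexx ?orbT//.
- exact: I5_ge0.
- by move=> c c0 ineq; exact: I5_le.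
- by move=> c c0 Ic; rewrite /kB -mulrA; exact: inequality_I5.
Qed.
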